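(* Let $X$ be a compact Ptolemy space with properties (E) and (sI). Then $X$ is Möbius equivalent to the extended Euclidean space $\widehat{\mathbb{R}}^n=\mathbb{R}^n\cup\{\infty\}$ for some $n\ge 1$.
   Context: An extended metric $d$ on a set $X$ is a metric for which the existence of one infinitely remote point $\omega\in X$ is allowed: $d(x,\omega)=\infty$ for all $x\ne\omega$, $d(\omega,\omega)=0$ (such a point is unique if it exists). A quadruple $Q=(x,y,z,u)$ of points of $X$ is admissible if no entry occurs three or four times in $Q$. Its cross-ratio triple is $\mathrm{crt}_d(Q)=(d(x,y)d(z,u):d(x,z)d(y,u):d(x,u)d(y,z))\in\mathbb{R}P^2$, where infinite factors are cancelled: if $\infty$ denotes the infinitely remote point, $\mathrm{crt}_d(x,y,z,\infty)=(d(x,y):d(x,z):d(y,z))$ and $\mathrm{crt}_d(x,y,\infty,\infty)=(0:1:1)$ (similarly for other positions). Two extended metrics $d,d'$ on $X$ are Möbius equivalent if $\mathrm{crt}_d(Q)=\mathrm{crt}_{d'}(Q)$ for every admissible $Q$. A Möbius structure $\mathcal{M}$ on $X$ is an equivalence class of pairwise Möbius equivalent extended metrics; $(X,\mathcal{M})$ is a Möbius space. Its topology is generated by the open balls $B_r(x)$ around points $x$ that are not infinitely remote, and the complements of closed balls $\overline B_r(x)$, for any $d\in\mathcal{M}$ (it does not depend on $d$). A map between Möbius spaces is Möbius if it is injective and preserves cross-ratio triples of all admissible quadruples; two Möbius spaces are Möbius equivalent if there is a bijective Möbius map between them; a Möbius automorphism is a bijective Möbius self-map. A Möbius space is a Ptolemy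 space if for every admissible $Q$ the three entries of $\mathrm{crt}(Q)$ satisfy the triangle inequality; then for every $z\in X$ there is a metric in $\mathcal{M}$ with infinitely remote point $z$, unique up to scaling. A Ptolemy circle is a subset $\sigma\subset X$ homeomorphic to $S^1$ such that $d(x,z)d(y,u)=d(x,y)d(z,u)+d(x,u)d(y,z)$ for some (hence any) $d\in\mathcal{M}$ and all distinct $x,y,z,u\in\sigma$ such that $y,u$ lie in different components of $\sigma\setminus\{x,z\}$. For distinct $\omega,\omega'\in X$, a metric sphere between $\omega,\omega'$ is a set $S=\{x\in X: d(x,\omega)=r\}$ for some $d\in\mathcal{M}$ with infinitely remote point $\omega'$ and some $r>0$ (the notion is symmetric in $\omega,\omega'$). A strong space inversion (s-inversion) w.r.t. $\omega,\omega',S$ is a Möbius automorphism $\phi:X\to X$ such that (1) $\phi^2=\mathrm{id}$; (2) $\phi(\omega)=\omega'$; (3) $\phi(x)=x$ for every $x\in S$; (4) $\phi(\sigma)=\sigma$ for every Ptolemy circle $\sigma\subset X$ through $\omega,\omega'$. (E): there is at least one Ptolemy circle in $X$. (sI): for any distinct $\omega,\omega'\in X$ and any metric sphere $S$ between them there is an s-inversion w.r.t. $\omega,\omega',S$. The Möbius structure of $\widehat{\mathbb{R}}^n$ is the one generated by the Euclidean metric with infinitely remote point $\infty$. *)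

(* Defs.v *)
From HB Require Import structures.
From mathcomp Require Import all_boot all_order all_algebra.
From mathcomp Require Import ring lra.
From mathcomp Require Import all_classical all_reals all_analysis.

Set Implicit Arguments.
Unset Strict Implicit.
Unset Printing Implicit Defensive.

Import Order.TTheory GRing.Theory Num.Theory.
Import numFieldNormedType.Exports.
Local Open Scope classical_set_scope.
Local Open Scope ring_scope.

Definition infinitely_remote (R : realType) (X : Type) (d : X -> X -> \bar R)
  (w : X) : Prop := forall x, x <> w -> d x w = +oo%E.

Record is_ext_metric (R : realType) (X : Type) (d : X -> X -> \bar R) : Prop :=
  IsExtMetric {
  ext_metric_ge0 : forall x y, (0 <= d x y)%E;
  ext_metric_eq0 : forall x y, d x y = 0%E <-> x = y;
  ext_metric_sym : forall x y, d x y = d y x;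
  ext_metric_triangle : forall x y z, (d x z <= d x y + d y z)%E;
  ext_metric_infty :
    (forall x y, (d x y < +oo)%E) \/
    (exists w, infinitely_remote d w /\
       forall x y, x <> w -> y <> w -> (d x y < +oo)%E) }.

Definition admissible (X : Type) (x y z u : X) : Prop :=
  [/\ ~ (x = y /\ y = z), ~ (x = y /\ y = u),
      ~ (x = z /\ z = u) & ~ (y = z /\ z = u)].

(* A distance as a factor of a cross-ratio entry, an infinite factor being
   replaced by 1. In an admissible quadruple containing the infinitely remote
   point k times (k <= 2), every entry without a zero factor d(w,w) has exactly
   k infinite factors, so this replacement is their cancellation: see
   [crt_remote1] and [crt_remote2]. *)
Definition cancel_infty (R : realType) (e : \bar R) : R :=
  if e is r%:E then r else 1.

(* Homogeneous coordinates of the cross-ratio triple. *)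
Definition crt (R : realType) (X : Type) (d : X -> X -> \bar R)
    (x y z u : X) : R * R * R :=
  let c p q := cancel_infty (d p q) in
  (c x y * c z u, c x z * c y u, c x u * c y z).

(* Equality of points of the projective plane in homogeneous coordinates. *)
Definition proj_eq (R : realType) (a b : R * R * R) : Prop :=
  exists k : R, k != 0 /\
    [/\ a.1.1 = k * b.1.1, a.1.2 = k * b.1.2 & a.2 = k * b.2].

Lemma crt_remote1 (R : realType) (X : Type) (d : X -> X -> \bar R)
    (w x y z : X) : infinitely_remote d w -> x <> w -> y <> w -> z <> w ->
  crt d x y z w =
  (cancel_infty (d x y), cancel_infty (d x z), cancel_infty (d y z)).
Proof.
by move=> dw xw yw zw; rewrite /crt !dw//= !mulr1 mul1r.
Qed.

Lemma crt_remote2 (R : realType) (X : Type) (d : X -> X -> \bar R)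
    (w x y : X) : is_ext_metric d -> infinitely_remote d w ->
  x <> w -> y <> w -> crt d x y w w = (0, 1, 1).
Proof.
move=> dm dw xw yw; have dww : d w w = 0%E by apply/(ext_metric_eq0 dm).
by rewrite /crt dww !dw//= mulr0 mulr1.
Qed.

Definition mobius_equiv_metric (R : realType) (X : Type)
    (d d' : X -> X -> \bar R) : Prop :=
  forall x y z u, admissible x y z u ->
    proj_eq (crt d x y z u) (crt d' x y z u).

Definition mobius_class (R : realType) (X : Type) (d : X -> X -> \bar R) :
    set (X -> X -> \bar R) :=
  [set d' | is_ext_metric d' /\ mobius_equiv_metric d d'].

Record mobius_structure (R : realType) (X : Type) := MobiusStructure {
  mobius_metrics : set (X -> X -> \bar R);
  mobius_metricsP : exists d, is_ext_metric d /\
    mobius_metrics = mobius_class d }.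

Definition generated_mobius (R : realType) (X : Type) (d : X -> X -> \bar R)
    (dm : is_ext_metric d) : mobius_structure R X :=
  MobiusStructure (ex_intro _ d (conj dm erefl)).

(* All metrics of a structure generate the same topology, so the subbase can be
   taken over all of them at once. *)
Definition mobius_subbase (R : realType) (X : Type)
    (M : mobius_structure R X) : set (set X) :=
  [set U | exists d x (r : R),
     [/\ mobius_metrics M d, ~ infinitely_remote d x, 0 < r &
         U = [set y | (d x y < r%:E)%E] \/
         U = ~` [set y | (d x y <= r%:E)%E]]].

(* [X] with the topology of the Möbius structure [M]. *)
Definition mobius_space (R : realType) (X : Type) (M : mobius_structure R X) :
  Type := X.

HB.instance Definition _ (R : realType) (X : Type) (M : mobius_structure R X) :=
  gen_eqMixin (mobius_space M).
HB.instance Definition _ (R : realType) (X : Type) (M : mobius_structure R X) :=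
  gen_choiceMixin (mobius_space M).
HB.instance Definition _ (R : realType) (X : Type) (M : mobius_structure R X) :=
  isSubBaseTopological.Build (mobius_space M) (mobius_subbase M) id.

Definition is_mobius_map (R : realType) (X Y : Type)
    (M : mobius_structure R X) (N : mobius_structure R Y) (f : X -> Y) : Prop :=
  injective f /\
  forall d e, mobius_metrics M d -> mobius_metrics N e ->
  forall x y z u, admissible x y z u ->
    proj_eq (crt d x y z u) (crt e (f x) (f y) (f z) (f u)).

Definition mobius_equivalent (R : realType) (X Y : Type)
    (M : mobius_structure R X) (N : mobius_structure R Y) : Prop :=
  exists f : X -> Y, bijective f /\ is_mobius_map M N f.

Definition mobius_automorphism (R : realType) (X : Type)
    (M : mobius_structure R X) (f : X -> X) : Prop :=
  bijective f /\ is_mobius_map M M f.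

Definition is_ptolemy (R : realType) (X : Type) (M : mobius_structure R X) :
    Prop :=
  forall d, mobius_metrics M d -> forall x y z u, admissible x y z u ->
    let: (a, b, c) := crt d x y z u in [/\ a <= b + c, b <= a + c & c <= a + b].

Definition homeomorphic (S T : topologicalType) : Prop :=
  exists (f : S -> T) (g : T -> S),
    [/\ cancel f g, cancel g f, continuous f & continuous g].

Definition unit_circle (R : realType) : set (R * R) :=
  [set p | p.1 ^+ 2 + p.2 ^+ 2 = 1].

(* The Ptolemy equality is read on the cross-ratio triple, so that it makes
   sense when one of the four points is infinitely remote. *)
Definition ptolemy_circle (R : realType) (X : Type) (M : mobius_structure R X)
    (sigma : set (mobius_space M)) : Prop :=
  homeomorphic (set_type sigma) (set_type (@unit_circle R)) /\
  exists2 d, mobius_metrics M d & forall x y z u : mobius_space M,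
    sigma x -> sigma y -> sigma z -> sigma u -> uniq [:: x; y; z; u] ->
    connected_component (sigma `\` [set x; z]) y <>
    connected_component (sigma `\` [set x; z]) u ->
    let: (a, b, c) := crt d x y z u in b = a + c.

Definition metric_sphere (R : realType) (X : Type) (M : mobius_structure R X)
    (w w' : X) (S : set X) : Prop :=
  exists d (r : R), [/\ mobius_metrics M d, infinitely_remote d w', 0 < r &
    S = [set x | d x w = r%:E]].

Definition s_inversion (R : realType) (X : Type) (M : mobius_structure R X)
    (w w' : X) (S : set X) (phi : X -> X) : Prop :=
  mobius_automorphism M phi /\
  [/\ forall x, phi (phi x) = x,
      phi w = w',
      forall x, S x -> phi x = x &
      forall sigma : set (mobius_space M), ptolemy_circle sigma ->
        sigma w -> sigma w' -> phi @` sigma = sigma].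

Definition propertyE (R : realType) (X : Type) (M : mobius_structure R X) :
    Prop :=
  exists sigma : set (mobius_space M), ptolemy_circle sigma.

Definition property_sI (R : realType) (X : Type) (M : mobius_structure R X) :
    Prop :=
  forall (w w' : X) (S : set X), w <> w' -> metric_sphere M w w' S ->
    exists phi : X -> X, s_inversion M w w' S phi.

(* The norm of ['rV[R]_n] in the library is the max norm. *)
Definition euclidean_norm (R : realType) (n : nat) (v : 'rV[R]_n) : R :=
  Num.sqrt (\sum_(i < n) v ord0 i ^+ 2).

(* [None] is the point at infinity. *)
Definition ext_euclidean_dist (R : realType) (n : nat)
    (p q : option 'rV[R]_n) : \bar R :=
  match p, q with
  | Some x, Some y => (euclidean_norm (x - y))%:E
  | None, None => 0%E
  | _, _ => +oo%E
  end.

Lemma sum_CauchySchwarz (R : realType) (n : nat) (a b : 'I_n -> R) :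
  (\sum_i a i * b i) ^+ 2 <= (\sum_i a i ^+ 2) * (\sum_i b i ^+ 2).
Proof.
have : 0 <= \sum_i \sum_j (a i * b j - a j * b i) ^+ 2.
  by apply: sumr_ge0 => i _; apply: sumr_ge0 => j _; exact: sqr_ge0.
suff -> : \sum_i \sum_j (a i * b j - a j * b i) ^+ 2 =
    2 * ((\sum_i a i ^+ 2) * (\sum_i b i ^+ 2) - (\sum_i a i * b i) ^+ 2).
  by rewrite pmulr_rge0// subr_ge0.
have E (f g : 'I_n -> R) :
    (\sum_i f i) * (\sum_i g i) = \sum_i \sum_j f i * g j.
  by rewrite mulr_suml; apply: eq_bigr => i _; rewrite mulr_sumr.
rewrite mulrBr [2 * _]mulrDl mul1r [X in _ + X - _]mulrC expr2 !E.
rewrite mulr_sumr -sumrN -!big_split/=; apply: eq_bigr => i _.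
rewrite mulr_sumr -sumrN -!big_split/=; apply: eq_bigr => j _.
ring.
Qed.

Lemma euclidean_normD (R : realType) (n : nat) (v w : 'rV[R]_n) :
  euclidean_norm (v + w) <= euclidean_norm v + euclidean_norm w.
Proof.
have ss_ge0 (x : 'rV[R]_n) : 0 <= \sum_i x ord0 i ^+ 2.
  by apply: sumr_ge0 => i _; exact: sqr_ge0.
rewrite /euclidean_norm -[leRHS]ger0_norm ?addr_ge0 ?sqrtr_ge0//.
rewrite -sqrtr_sqr ler_sqrt ?sqr_ge0// sqrrD !sqr_sqrtr//.
under eq_bigr do rewrite mxE sqrrD.
rewrite !big_split/= lerD2r lerD2l -mulr2n lerMn2r/=.
rewrite -sqrtrM//; apply: le_trans (ler_norm _) _.
rewrite -sqrtr_sqr ler_sqrt ?mulr_ge0//.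
exact: (sum_CauchySchwarz (fun i => v ord0 i) (fun i => w ord0 i)).
Qed.

Lemma ext_euclidean_is_ext_metric (R : realType) (n : nat) :
  is_ext_metric (@ext_euclidean_dist R n).
Proof.
split.
- by move=> [x|] [y|]//=; rewrite lee_fin sqrtr_ge0.
- move=> [x|] [y|]//=; split=> //.
  + move=> [] /eqP; rewrite sqrtr_eq0 => s0.
    congr Some; apply/rowP => i; apply/eqP; rewrite -subr_eq0 -sqrf_eq0.
    have sq_ge0 j : true -> 0 <= (x - y) ord0 j ^+ 2 by rewrite sqr_ge0.
    have /eqP : \sum_j (x - y) ord0 j ^+ 2 = 0.
      by apply/le_anti; rewrite s0 sumr_ge0.
    rewrite psumr_eq0// => /allP/(_ i); rewrite mem_index_enum => /(_ isT).
    by rewrite /= !mxE.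
  + move=> [->]; rewrite subrr /euclidean_norm big1 ?sqrtr0// => i _.
    by rewrite mxE expr0n.
- move=> [x|] [y|]//=; congr (Num.sqrt _)%:E; apply: eq_bigr => i _.
  by rewrite -opprB mxE sqrrN.
- move=> [x|] [y|] [z|]//=; rewrite ?leey ?adde0// -EFinD lee_fin.
  have -> : x - z = (x - y) + (y - z) by rewrite addrA subrK.
  exact: euclidean_normD.
- right; exists None; split; first by case.
  by move=> [x|] [y|]//= _ _; rewrite ltry.
Qed.

Definition euclidean_mobius (R : realType) (n : nat) :
    mobius_structure R (option 'rV[R]_n) :=
  generated_mobius (@ext_euclidean_is_ext_metric R n).

(* Main.v *)
From HB Require Import structures.
Require Import Defs.
From mathcomp Require Import all_boot all_order all_algebra.
From mathcomp Require Import ring lra.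
From mathcomp Require Import all_classical all_reals all_analysis.
Local Open Scope classical_set_scope.

Set Implicit Arguments.
Unset Strict Implicit.
Unset Printing Implicit Defensive.

Import Order.TTheory GRing.Theory Num.Theory.
Import numFieldNormedType.Exports.
Local Open Scope ring_scope.

(** The theorem holds because strong inversions, once a point [w] is sent to
infinity, become mirror reflections, and a space with enough mirrors is
Euclidean.

Choose [w] on a Ptolemy circle and a metric of the structure with infinitely
remote point [w]; let [Y] be the set of the other points and [D] the metric on
it. For [p <> q] in [Y], the points equidistant from [p] and [q], together with
[w], form a metric sphere between [p] and [q]. The s-inversion in this sphere
fixes [w], so it is a similarity of [Y], and it exchanges [p] and [q], so it is
an isometry: a reflection fixing the bisector of [p] and [q] pointwise. In the
same way the s-inversions exchanging [o] and [w] are the inversions of [Y] with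
centre [o] and arbitrary radius. Ptolemy circles through [w] are isometric
copies of the line in [Y], because the Ptolemy equality becomes additivity of
distances along them. As s-inversions preserve the Ptolemy circles through the
two points they exchange, the reflection in the bisector of two points of such
a line reverses the line, and an inversion centred on it acts on it by the
usual formula. Everything that is used afterwards is recorded in
[mirror_space]; the instance is [finite_mirror_space].

In a mirror space the distance from [y] to a moving point of a line is
symmetric about any parameter midway between two equal values
([dist_line_symmetric]) and convex by the Ptolemy inequality; as it is not
periodic, it has a unique minimum, the foot of the perpendicular
([foot_exists]). Reflections move the given line so that it joins any two
points ([line_through]), and inversions show that two points lie on only one
line ([line_unique]); composing two inversions with the same centre yields
homotheties ([homothety_lines]). The Pythagorean theorem is then proved by
similar triangles ([pythagoras]): in a right triangle with legs [a], [b] and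
hypotenuse [c], homotheties and an inversion centred at one end of the
hypotenuse place the foot of the altitude at distance [a^2/c] from that end
([altitude_foot]), and by symmetry at distance [b^2/c] from the other end, so
[a^2/c + b^2/c = c].

By Pythagoras the squared distance to a point moving on a line is a monic
quadratic polynomial in its parameter. Consequently the function defined from
distances by the law of cosines is additive and homogeneous along lines, and
the Gram-Schmidt process applies to it. Compactness of the Moebius space bounds
the size of an orthonormal family ([finite_separated_bound]), so a maximal one
exists, and its coordinates are an isometry of [Y] onto a Euclidean space
([mirror_space_euclidean]). Extended by sending [w] to the point at infinity,
it is the Moebius equivalence. *)

(** * Metric spaces with reflections and inversions *)

(** [D] is a Ptolemaic metric and [L] a class of isometrically parametrized
lines. [inversion_lines] is the effect on distances of the inversion with
radius [sqrt k] centred at the common point of [l] and [m]. It is stated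
without the inversion itself, because every figure to be inverted lies on two
lines through the centre. *)
Record mirror_space (R : realType) (Y : Type) (D : Y -> Y -> R)
    (L : (R -> Y) -> Prop) : Prop := MirrorSpace {
  dist_ge0 : forall x y, 0 <= D x y;
  dist_eq0 : forall x y, D x y = 0 <-> x = y;
  dist_sym : forall x y, D x y = D y x;
  dist_triangle : forall x y z, D x z <= D x y + D y z;
  dist_ptolemy : forall x y z u,
    D x z * D y u <= D x y * D z u + D x u * D y z;
  line_exists : exists l, L l;
  line_dist : forall l s t, L l -> D (l s) (l t) = `|s - t|;
  line_shift : forall l c, L l -> L (fun s => l (c + s));
  line_flip : forall l c, L l -> L (fun s => l (c - s));
  reflection : forall p q, p <> q -> exists phi : Y -> Y,
    [/\ forall x y, D (phi x) (phi y) = D x y,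
        phi p = q,
        forall x, D x p = D x q -> phi x = x,
        forall l, L l -> L (phi \o l) &
        forall l a b, L l -> l a = p -> l b = q ->
          forall s, phi (l s) = l (a + b - s)];
  inversion_lines : forall l m a b k s u, L l -> L m -> l a = m b ->
    0 < k -> s != 0 -> u != 0 ->
    D (l (a + k / s)) (m (b + k / u)) =
      k * D (l (a + s)) (m (b + u)) / (`|s| * `|u|) }.

Lemma lipschitz1_continuous (R : realType) (f : R -> R) :
  (forall s t, f s <= f t + `|s - t|) -> continuous f.
Proof.
move=> fL t; apply/cvgrPdist_le => e e0; near=> s.
have ts : `|t - s| <= e by near: s; apply: cvgr_dist_le.
rewrite ler_norml; have := fL s t; have := fL t s; rewrite distrC.
rewrite distrC in ts *; lra.
Unshelve. all: by end_near. Qed.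

(** * Perpendiculars, homotheties and the Pythagorean theorem *)

Section MirrorSpace.
Variables (R : realType) (Y : Type) (D : Y -> Y -> R) (L : (R -> Y) -> Prop).
Hypothesis mY : mirror_space D L.

Let Dge0 := dist_ge0 mY.
Let Dsym := dist_sym mY.
Let Dtri := dist_triangle mY.
Let Ldist := line_dist mY.

Let Dxx x : D x x = 0. Proof. by apply/(dist_eq0 mY). Qed.

Let Dgt0 x y : x <> y -> 0 < D x y.
Proof.
by move=> xy; rewrite lt_neqAle Dge0 andbT; apply/eqP => /esym /(dist_eq0 mY).
Qed.

Lemma line_inj l a b : L l -> l a = l b -> a = b.
Proof.
move=> Ll /(dist_eq0 mY) /eqP.
by rewrite Ldist// normr_eq0 subr_eq0 => /eqP.
Qed.

(** If [y] is equidistant from two points of a line, the reflection exchanging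
them fixes [y] and reverses the line. *)
Lemma dist_line_symmetric l y a b : L l -> a != b -> D y (l a) = D y (l b) ->
  forall s, D y (l s) = D y (l (a + b - s)).
Proof.
move=> Ll ab yab s.
have lab : l a <> l b by move=> /(line_inj Ll) /eqP; rewrite (negbTE ab).
have [phi [iso _ fixed _ flip]] := reflection mY lab.
by rewrite -(flip l a b Ll erefl erefl) -{2}(fixed y yab) iso.
Qed.

Lemma dist_line_lipschitz l y s t : L l -> D y (l s) <= D y (l t) + `|s - t|.
Proof. by move=> Ll; rewrite distrC -(Ldist t s Ll); exact: Dtri. Qed.

Lemma dist_line_ge l y s t : L l -> `|s - t| <= D y (l s) + D y (l t).
Proof. by move=> Ll; rewrite -(Ldist s t Ll) (Dsym y (l s)); exact: Dtri. Qed.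

Lemma dist_line_convex l y a b c : L l -> a <= b -> b <= c ->
  D y (l b) * (c - a) <= D y (l a) * (c - b) + D y (l c) * (b - a).
Proof.
move=> Ll ab bc; have := dist_ptolemy mY y (l a) (l b) (l c).
rewrite !Ldist// [`|a - c|]distrC [`|b - c|]distrC [`|a - b|]distrC.
by rewrite !ger0_norm ?subr_ge0 ?(le_trans ab bc).
Qed.

(** Convexity gives the weak inequality. In case of equality the function would
be symmetric about two different parameters, hence periodic, which is
impossible for the distance to an unbounded line. *)
Lemma dist_line_mid_lt l y a b : L l -> a < b -> D y (l a) = D y (l b) ->
  D y (l ((a + b) / 2)) < D y (l a).
Proof.
move=> Ll ab yab; set c := (a + b) / 2.
have ac : a < c by rewrite /c; lra.
have cb : c < b by rewrite /c; lra.
rewrite lt_neqAle; apply/andP; split; last first.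
  have := dist_line_convex y Ll (ltW ac) (ltW cb); rewrite -yab.
  rewrite -mulrDr subrKA ler_pM2r// subr_gt0; exact: lt_trans cb.
apply/eqP => yac.
have per s : D y (l (s + (b - c))) = D y (l s).
  have ac' : a != c by rewrite lt_eqF.
  have ab' : a != b by rewrite lt_eqF.
  rewrite (dist_line_symmetric Ll ab' yab).
  by rewrite (dist_line_symmetric Ll ac' (esym yac) s); congr (D y (l _)); ring.
have perN n : D y (l (a + n%:R * (b - c))) = D y (l a).
  elim: n => [|n <-]; first by rewrite mul0r addr0.
  by rewrite -[RHS]per -natr1; congr (D y (l _)); ring.
have T0 : 0 < b - c by rewrite subr_gt0.
pose n := Num.bound (2 * D y (l a) / (b - c)).
have nP : 2 * D y (l a) < n%:R * (b - c).
  rewrite -ltr_pdivrMr//; apply: archi_boundP.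
  by rewrite divr_ge0 ?mulr_ge0 ?Dge0 ?ltW.
have := dist_line_ge y (a + n%:R * (b - c)) a Ll.
rewrite perN (addrC a) addrK ger0_norm; last by rewrite mulr_ge0 ?ltW.
lra.
Qed.

(** The foot of the perpendicular from [y]. The distance to [l s] tends to
infinity at both ends, so by continuity it takes some value twice; its minimum
is then midway between the two parameters. *)
Lemma foot_exists l y : L l -> exists c,
  (forall s, D y (l s) = D y (l (c + c - s))) /\
  (forall s, s != c -> D y (l c) < D y (l s)).
Proof.
move=> Ll; pose f s := D y (l s).
have fc : continuous f.
  by apply: lipschitz1_continuous => s t; exact: dist_line_lipschitz.
suff [a [b [ab fab]]] : exists a b, a < b /\ f a = f b.
  have ab' : a != b by rewrite lt_eqF.
  pose c := (a + b) / 2; exists c.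
  have sym s : D y (l s) = D y (l (c + c - s)).
    rewrite (dist_line_symmetric Ll ab' fab); congr (D y (l _)).
    by rewrite /c; lra.
  split=> // s sc; have [cs|sc'|/eqP] := ltgtP c s; last by
    rewrite eq_sym (negbTE sc).
  - have cs' : c + c - s < s by lra.
    have := dist_line_mid_lt Ll cs' (esym (sym s)).
    by rewrite -sym addrNK; congr (D y (l _) < _); lra.
  - have cs' : s < c + c - s by lra.
    have := dist_line_mid_lt Ll cs' (sym s).
    by congr (D y (l _) < _); lra.
(* Beyond distance [2 * f 0] from the origin the values of [f] exceed [f 0]. *)
pose M := f 0 + f 0 + 1.
have f0 : 0 <= f 0 by exact: Dge0.
have M0 : 0 < M by rewrite /M; lra.
have fM : f 0 < f M.
  have := dist_line_ge y M 0 Ll; rewrite subr0 gtr0_norm// -/(f _) -/(f 0).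
  by rewrite /M; lra.
have fNM : f 0 < f (- M).
  have := dist_line_ge y (- M) 0 Ll; rewrite subr0 normrN gtr0_norm//.
  by rewrite -/(f _) -/(f 0) /M; lra.
have [le|lt] := leP (f M) (f (- M)).
  have [|||a] := @IVT _ f (- M) 0 (f M).
  - lra.
  - exact: continuous_subspaceT.
  - by rewrite ge_min le_max (ltW fM) le orbT.
  rewrite in_itv/= => /andP[_ a0] fa; exists a, M; split=> //; lra.
have [|||b] := @IVT _ f 0 M (f (- M)).
- lra.
- exact: continuous_subspaceT.
- by rewrite ge_min le_max (ltW lt) (ltW fNM) orbT.
rewrite in_itv/= => /andP[b0 _] fb; exists (- M), b; split=> //; lra.
Qed.

(** A reflection carries a line to one through [p]; on it there is a point at
distance [D p q] from [p], and the reflection exchanging this point with [q]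
fixes [p]. *)
Lemma line_through p q : p <> q ->
  exists l, [/\ L l, l 0 = p & l (D p q) = q].
Proof.
move=> pq.
have [l [Ll l0]] : exists l, L l /\ l 0 = p.
  have [l Ll] := line_exists mY.
  have [<-|lp] := pselect (l 0 = p); first by exists l.
  have [phi [_ phip _ phiL _]] := reflection mY lp.
  by exists (phi \o l); split; [exact: phiL|].
have [lq|lq] := pselect (l (D p q) = q); first by exists l.
have [phi [_ phip fixed phiL _]] := reflection mY lq.
exists (phi \o l); split=> //=; first exact: phiL.
rewrite l0; apply: fixed; rewrite -{1}l0 Ldist// sub0r normrN ger0_norm//.
Qed.

(** An inversion centred at [l 0 = m 0] of suitable radius sends the common
point [l h = m h] both to [l t] and to [m t], for any [t > 0]; for [t < 0] the
same argument applies to the lines reversed at [l h]. *)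
Lemma line_unique l m h : L l -> L m -> 0 < h -> l 0 = m 0 -> l h = m h ->
  forall t, l t = m t.
Proof.
have pos l' m' : L l' -> L m' -> 0 < h -> l' 0 = m' 0 -> l' h = m' h ->
    forall t, 0 < t -> l' t = m' t.
  move=> Ll Lm h0 lm0 lmh t t0; apply/(dist_eq0 mY).
  have th0 : 0 < t * h by exact: mulr_gt0.
  have hn : h != 0 by rewrite gt_eqF.
  have := inversion_lines mY Ll Lm lm0 th0 hn hn.
  by rewrite !add0r mulfK// lmh Dxx mulr0 mul0r.
move=> Ll Lm h0 lm0 lmh t; have [t0|t0|->//] := ltgtP t 0; last exact: pos.
have := pos _ _ (line_flip mY h Ll) (line_flip mY h Lm) h0.
rewrite !subr0 !subrr => /(_ lmh lm0 (h - t)).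
rewrite subr_gt0 !subKr => -> //; exact: lt_trans h0.
Qed.

(** Inverting twice in a common centre, with radii [1] and [sqrt k]. *)
Lemma homothety_lines l m a b k s u : L l -> L m -> l a = m b -> 0 < k ->
  D (l (a + k * s)) (m (b + k * u)) = k * D (l (a + s)) (m (b + u)).
Proof.
move=> Ll Lm lm k0.
have [->|s0] := eqVneq s 0.
  rewrite mulr0 addr0 lm !Ldist// !opprD !addNKr.
  by rewrite !normrN normrM (gtr0_norm k0).
have [->|u0] := eqVneq u 0.
  rewrite mulr0 addr0 -lm !Ldist// ![a + _]addrC !addrK.
  by rewrite normrM (gtr0_norm k0).
have si : s^-1 != 0 by rewrite invr_eq0.
have ui : u^-1 != 0 by rewrite invr_eq0.
have := inversion_lines mY Ll Lm lm k0 si ui; rewrite !invrK => ->.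
have := inversion_lines mY Ll Lm lm ltr01 s0 u0; rewrite !div1r => ->.
rewrite !normfV mul1r; field; by rewrite !normr_eq0 u0 s0.
Qed.

(** Perpendicularity is symmetric: if the foot on [l] of one point of [n] is
the common point [l 0 = n 0], then [l 0] is the point of [n] nearest to every
[l s]. Reflections reversing [l] about [l 0] fix [n b], hence all of [n] by
[line_unique], so [l 0] is the foot on [l] of every [n t]; inverting at [l 0]
turns this into the statement with [l] and [n] exchanged. *)
Lemma perpendicular_sym l n b : L l -> L n -> l 0 = n 0 -> 0 < b ->
  (forall s, b <= D (n b) (l s)) -> forall t s, `|s| <= D (n t) (l s).
Proof.
move=> Ll Ln ln b0 bmin.
have Dnl t : D (n t) (l 0) = `|t| by rewrite ln Ldist// subr0.
have sym t s : D (n t) (l s) = D (n t) (l (- s)).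
  have [->|s0] := eqVneq s 0; first by rewrite oppr0.
  have lss : l s <> l (- s).
    move=> /(line_inj Ll) /eqP; rewrite -addr_eq0 -mulr2n mulrn_eq0/=.
    by rewrite (negbTE s0).
  have [phi [iso _ fixed phiL flip]] := reflection mY lss.
  have foot0 : D (n b) (l s) = D (n b) (l (- s)).
    have [c [csym cmin]] := foot_exists (n b) Ll.
    suff c0 : c = 0 by rewrite csym c0 addr0 sub0r.
    apply/eqP; apply/negPn/negP => c0; rewrite eq_sym in c0.
    have := cmin _ c0; rewrite Dnl gtr0_norm// => /lt_le_trans /(_ (bmin c)).
    by rewrite ltxx.
  have phin : forall t, phi (n t) = n t.
    apply: (line_unique (phiL _ Ln) Ln b0) => /=; apply: fixed => //.
    by rewrite -ln !Ldist// !sub0r opprK normrN.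
  rewrite -[LHS]iso phin (flip l s (- s) Ll erefl erefl).
  by congr (D _ (l _)); lra.
have tmin t s : `|t| <= D (n t) (l s).
  rewrite -Dnl; have [->//|s0] := eqVneq s 0.
  have [s1|s1|/eqP] := ltgtP s 0; last by rewrite (negbTE s0).
  - have := @dist_line_mid_lt l (n t) s (- s) Ll.
    by rewrite subrr mul0r => /(_ _ (sym t s)) /ltW; apply; lra.
  - have := @dist_line_mid_lt l (n t) (- s) s Ll.
    by rewrite addNr mul0r (sym t s) => /(_ _ erefl) /ltW; apply; lra.
move=> t s; have [->|s0] := eqVneq s 0; first by rewrite normr0.
have [->|t0] := eqVneq t 0; first by rewrite -ln Ldist// sub0r normrN.
have ti : t^-1 != 0 by rewrite invr_eq0.
have si : s^-1 != 0 by rewrite invr_eq0.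
have := inversion_lines mY Ln Ll (esym ln) ltr01 ti si.
rewrite !div1r !add0r !invrK mul1r => ->.
rewrite ler_pdivlMr ?mulr_gt0 ?normr_gt0// mulrCA -normrM divff//.
by rewrite normr1 mulr1.
Qed.

(** In the triangle with vertices [l 0], [l a = m 0] and [m c], with a right
angle at [l 0], the altitude from [l 0] meets the hypotenuse [m] at distance
[a^2/c] from [m 0]. A homothety centred at [m 0] shows that [m (t * c)] is at
distance at least [t * D (m c) (l 0)] from [l 0]. The inversion centred at [m
0] that fixes [l 0] exchanges [m s] with [m (a^2/s)] and turns this bound into
minimality of the distance at [m (a^2/c)] on a half-line; by convexity the
minimum is global. *)
Lemma altitude_foot l m a c : L l -> L m -> a != 0 -> 0 < c -> l a = m 0 ->
  (forall s, D (m c) (l 0) <= D (m c) (l s)) ->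
  forall s, s != a ^+ 2 / c -> D (l 0) (m (a ^+ 2 / c)) < D (l 0) (m s).
Proof.
move=> Ll Lm a0 c0 lm cmin; pose b := D (m c) (l 0).
have cn : c != 0 by rewrite gt_eqF.
have a2 : 0 < a ^+ 2 by rewrite exprn_even_gt0.
have inv s : s != 0 ->
    D (l 0) (m (a ^+ 2 / s)) = `|a| * D (l 0) (m s) / `|s|.
  move=> s0; have an : - a != 0 by rewrite oppr_eq0.
  have := inversion_lines mY Ll Lm lm a2 an s0.
  have -> : a + a ^+ 2 / - a = 0 by field.
  rewrite subrr !add0r normrN => ->.
  rewrite -real_normK ?num_real//; field; by rewrite !normr_eq0 s0.
have low t : 0 < t -> t * b <= D (l 0) (m (t * c)).
  move=> t0; have := homothety_lines (- (a / t)) c Ll Lm lm t0.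
  have -> : a + t * - (a / t) = 0 by field; rewrite gt_eqF.
  by rewrite !add0r => ->; rewrite ler_pM2l// Dsym; exact: cmin.
have v0 : 0 < a ^+ 2 / c by rewrite divr_gt0.
set v := a ^+ 2 / c in v0 *.
have vmin w : 0 < w -> D (l 0) (m v) <= D (l 0) (m w).
  move=> w0; have wn : a ^+ 2 / w != 0 by rewrite gt_eqF ?divr_gt0.
  have := inv _ wn; have -> : a ^+ 2 / (a ^+ 2 / w) = w.
    by field; rewrite a0 gt_eqF.
  move=> ->; rewrite (inv c cn) -[leLHS]mulrA -[leRHS]mulrA.
  rewrite ler_pM2l ?normr_gt0//.
  rewrite (gtr0_norm c0) gtr0_norm ?divr_gt0//.
  rewrite ler_pdivlMr ?divr_gt0// Dsym -/b.
  have := low (a ^+ 2 / w / c); rewrite divfK// => /(_ (divr_gt0 _ c0)).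
  by rewrite divr_gt0// => /(_ isT); congr (_ <= _); ring.
have [e [_ emin]] := foot_exists (l 0) Lm.
suff -> : v = e by [].
apply/eqP/negPn/negP => ve; have ev := emin _ ve.
have [e0|e0] := ltP 0 e.
  by have := vmin _ e0; rewrite leNgt ev.
have w1 : e <= v / 2 by lra.
have w2 : v / 2 <= v by lra.
have := dist_line_convex (l 0) Lm w1 w2.
have := vmin (v / 2); rewrite divr_gt0// => /(_ isT) vw.
apply/negP; rewrite -ltNge.
apply: (@lt_le_trans _ _ (D (l 0) (m v) * (v - e))); last first.
  by rewrite ler_wpM2r//; lra.
have -> : v - e = (v - v / 2) + (v / 2 - e) by ring.
rewrite [ltRHS]mulrDr ltrD2r ltr_pM2r//; lra.
Qed.

(** The foot of the altitude on the hypotenuse is located by [altitude_foot]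
from both of its ends; [perpendicular_sym] makes the second application
possible. *)
Lemma pythagoras l y : L l -> (forall s, D y (l 0) <= D y (l s)) ->
  forall s, D y (l s) ^+ 2 = D y (l 0) ^+ 2 + s ^+ 2.
Proof.
move=> Ll ymin s.
have [->|s0] := eqVneq s 0; first by rewrite expr0n addr0.
have [y0|/nesym y0] := pselect (y = l 0).
  rewrite y0 !Ldist// subrr sub0r normrN real_normK ?num_real//.
  by rewrite normr0 expr0n add0r.
have b0 := Dgt0 y0; set b := D (l 0) y in b0 *.
have [n [Ln n0 nb]] := line_through y0; rewrite -/b in nb.
have perp t : `|s| <= D (n t) (l s).
  apply: (perpendicular_sym Ll Ln _ b0) => // u.
  by rewrite nb /b Dsym.
have c0 : 0 < D (l s) y.
  have : 0 < `|s| by rewrite normr_gt0.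
  by move=> /lt_le_trans; apply; rewrite Dsym -nb.
set c := D (l s) y in c0.
have sy : l s <> y by move=> sy; move: c0; rewrite /c sy Dxx ltxx.
have [m [Lm m0 mc]] := line_through sy; rewrite -/c in mc.
have F1 : forall u, u != s ^+ 2 / c -> D (l 0) (m (s ^+ 2 / c)) < D (l 0) (m u).
  by apply: altitude_foot => //; rewrite mc.
have F2 : forall u, u != b ^+ 2 / c ->
    D (n 0) (m (c - b ^+ 2 / c)) < D (n 0) (m (c - u)).
  apply: (altitude_foot Ln (line_flip mY c Lm)) => //.
  - by rewrite gt_eqF.
  - by rewrite subr0 mc.
  - move=> t; rewrite subrr m0 n0 Ldist// subr0.
    by rewrite Dsym; exact: perp.
(* Both expressions are the position on [m] of the foot of the altitude. *)
suff : s ^+ 2 / c = c - b ^+ 2 / c.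
  have cn : c != 0 by rewrite gt_eqF.
  move=> /(congr1 ( *%R^~ c)); rewrite mulrBl !divfK// -expr2 => E.
  by rewrite Dsym -/c (Dsym y) -/b; lra.
apply/eqP/negPn/negP => ne.
have ne' : c - s ^+ 2 / c != b ^+ 2 / c by apply/eqP; move/eqP: ne; lra.
rewrite eq_sym in ne; have := F1 _ ne; have := F2 _ ne'.
by rewrite n0 subKr => /ltW; rewrite leNgt => /negbTE ->.
Qed.

Lemma dist_line_sqr l y : L l ->
  exists c h, forall s, D y (l s) ^+ 2 = h + (s - c) ^+ 2.
Proof.
move=> Ll; have [c [_ cmin]] := foot_exists y Ll.
exists c, (D y (l c) ^+ 2) => s.
have := @pythagoras _ y (line_shift mY c Ll) _ (s - c).
rewrite addr0 subrKC; apply=> u.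
have [->|u0] := eqVneq u 0; first by rewrite addr0.
by apply/ltW/cmin; rewrite -subr_eq0 addrC addKr.
Qed.

(** Stewart's theorem: the squared distance to a point moving on the line
through [p] and [q] is a monic quadratic polynomial in the arc length, hence
determined by its values at [p] and [q]. *)
Lemma affine_combination p q t : exists z, forall y,
  D y z ^+ 2 =
    (1 - t) * D y p ^+ 2 + t * D y q ^+ 2 - t * (1 - t) * D p q ^+ 2.
Proof.
have [->|pq] := pselect (p = q).
  by exists q => y; rewrite Dxx expr0n/= mulr0; ring.
have r0 := Dgt0 pq; have [l [Ll lp lq]] := line_through pq.
exists (l (t * D p q)) => y; have [c [h E]] := dist_line_sqr y Ll.
by rewrite -lp -lq !E lp lq; ring.
Qed.

(** * Coordinates *)

Variable o : Y.

(** The law of cosines at [o]. *)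
Definition inner_product x y := (D o x ^+ 2 + D o y ^+ 2 - D x y ^+ 2) / 2.
Local Notation "[ x , y ]" := (inner_product x y).

Lemma inner_sym x y : [x, y] = [y, x].
Proof. by rewrite /inner_product (Dsym x y); ring. Qed.

Lemma innerxx x : [x, x] = D o x ^+ 2.
Proof. by rewrite /inner_product Dxx; field. Qed.

Lemma dist_inner x y : D x y ^+ 2 = [x, x] - 2 * [x, y] + [y, y].
Proof. by rewrite !innerxx /inner_product; field. Qed.

(** No vector space structure on [Y] is constructed: a linear combination is
any point having the right products with all points. *)
Lemma inner_scale x t : exists z, forall y, [y, z] = t * [y, x].
Proof.
have [z E] := affine_combination o x t; exists z => y.
by rewrite /inner_product !E Dxx (Dsym y o); field.
Qed.

Lemma inner_add x x' : exists z, forall y, [y, z] = [y, x] + [y, x'].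
Proof.
have [m E] := affine_combination x x' (1 / 2).
have [z F] := inner_scale m 2; exists z => y.
by rewrite F /inner_product !E; field.
Qed.

Lemma inner_sum n (v : 'I_n -> R) (e : 'I_n -> Y) :
  exists z, forall y, [y, z] = \sum_i v i * [y, e i].
Proof.
suff [z E] : exists z, forall y,
    [y, z] = \sum_(i <- index_enum 'I_n) v i * [y, e i].
  by exists z.
elim: (index_enum 'I_n) => [|i s [z IH]].
  exists o => y; rewrite big_nil /inner_product Dxx (Dsym y o) expr0n/=.
  by rewrite addr0 subrr mul0r.
have [x E] := inner_scale (e i) (v i); have [z' F] := inner_add x z.
by exists z' => y; rewrite F E IH big_cons.
Qed.

Definition orthonormal n (e : 'I_n -> Y) :=
  forall i j, [e i, e j] = (i == j)%:R.

(** If the formula holds on the diagonal it holds everywhere by polarization.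
Otherwise some [x] differs from its projection to the span of [e], and the
normalized difference extends the family. *)
Lemma gram_schmidt n (e : 'I_n -> Y) : orthonormal e ->
  (exists e' : 'I_n.+1 -> Y, orthonormal e') \/
  forall x y, [x, y] = \sum_i [x, e i] * [y, e i].
Proof.
move=> eo; have [[x xw]|noext] :=
    pselect (exists x, [x, x] <> \sum_i [x, e i] * [x, e i]); last first.
  right=> x y; have noext' z : [z, z] = \sum_i [z, e i] * [z, e i].
    by apply: contrapT => zE; apply: noext; exists z.
  (* Polarization, with [z] playing the role of [x + y]. *)
  have [z E] := inner_add x y.
  have := noext' z.
  rewrite E ![ [z, _] ]inner_sym !E (inner_sym y x) !noext'.
  have -> : \sum_i [z, e i] * [z, e i] = \sum_i [x, e i] * [x, e i] +
      \sum_i [y, e i] * [y, e i] + 2 * \sum_i [x, e i] * [y, e i].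
    rewrite mulr_sumr -!big_split/=; apply: eq_bigr => i _.
    by rewrite inner_sym E ![ [e i, _] ]inner_sym; ring.
  move=> H; lra.
left; have [p pE] := inner_sum (fun i => - [x, e i]) e.
have [w wE] := inner_add x p.
have we i : [e i, w] = 0.
  have sum_i : \sum_j - [x, e j] * [e i, e j] = - [x, e i].
    rewrite (bigD1 i)//= eo eqxx mulr1 big1 ?addr0// => j ji.
    by rewrite eo eq_sym (negbTE ji) mulr0.
  by rewrite wE pE sum_i (inner_sym (e i)) subrr.
have ww : [w, w] = [x, x] - \sum_i [x, e i] * [x, e i].
  rewrite wE pE big1; last by move=> i _; rewrite (inner_sym w) we mulr0.
  rewrite addr0 inner_sym wE pE -sumrN; congr (_ + _).
  by apply: eq_bigr => i _; rewrite mulNr.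
have ow : 0 < D o w.
  rewrite lt_neqAle Dge0 andbT; apply/eqP => ow; apply: xw.
  by apply/eqP; rewrite -subr_eq0 -ww innerxx -ow expr0n.
have [u uE] := inner_scale w (D o w)^-1.
have uu : [u, u] = 1.
  rewrite uE inner_sym uE innerxx; field; by rewrite gt_eqF.
have eu i : [e i, u] = 0 by rewrite uE we mulr0.
exists (fun i => if unlift ord0 i is Some j then e j else u) => i j.
case: unliftP => [i'|] ->; case: unliftP => [j'|] ->.
- by rewrite eo (inj_eq lift_inj).
- by rewrite eu.
- by rewrite inner_sym eu.
- by rewrite uu eqxx.
Qed.

Lemma orthonormal_dist n (e : 'I_n -> Y) i j :
  orthonormal e -> i != j -> D (e i) (e j) ^+ 2 = 2.
Proof.
by move=> eo ij; rewrite dist_inner !eo !eqxx (negbTE ij) mulr0 subr0 -mulr2n.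
Qed.

(** The points of an orthonormal family lie in the unit ball around [o] at
mutual distances [sqrt 2], so the separation bound provides a maximal family.
*)
Theorem mirror_space_euclidean :
  (exists N, forall m (u : 'I_m -> Y), (forall i, D o (u i) <= 1) ->
     (forall i j, i != j -> 1 <= D (u i) (u j)) -> (m <= N)%N) ->
  exists n (f : Y -> 'rV[R]_n), [/\ (1 <= n)%N, bijective f &
    forall x y, D x y = euclidean_norm (f x - f y)].
Proof.
move=> [N sep].
have bounded n : `[< exists e : 'I_n -> Y, orthonormal e >] -> (n <= N)%N.
  move=> /asboolP[e eo]; apply: (sep n e) => [i|i j ij].
    rewrite -(@ler_pXn2r _ 2)// ?nnegrE// -innerxx eo eqxx expr1n//.
  rewrite -(@ler_pXn2r _ 2)// ?nnegrE// orthonormal_dist// expr1n; lra.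
have ex0 : exists n, `[< exists e : 'I_n -> Y, orthonormal e >].
  by exists 0%N; apply/asboolP; exists (fun=> o) => -[].
have [n /asboolP[e eo] nmax] := ex_maxnP ex0 bounded.
have full x y : [x, y] = \sum_i [x, e i] * [y, e i].
  have [[e' e'o]|] := gram_schmidt eo; last exact.
  have /nmax : `[< exists e : 'I_n.+1 -> Y, orthonormal e >].
    by apply/asboolP; exists e'.
  by rewrite ltnn.
pose f x : 'rV[R]_n := \row_i [x, e i].
have fD x y : D x y = euclidean_norm (f x - f y).
  rewrite /euclidean_norm -[LHS]ger0_norm// -sqrtr_sqr; congr Num.sqrt.
  rewrite dist_inner !full mulr_sumr -sumrN -!big_split/=.
  by apply: eq_bigr => i _; rewrite !mxE; ring.
exists n, f; split=> //.
- case: n => [|//] in e eo nmax full f fD *.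
  have [l Ll] := line_exists mY.
  have := Ldist 0 1 Ll; rewrite fD /euclidean_norm big_ord0 sqrtr0 sub0r.
  by rewrite normrN normr1 => /eqP; rewrite eq_sym oner_eq0.
- pose g (v : 'rV[R]_n) := proj1_sig (cid (inner_sum (fun i => v ord0 i) e)).
  have fg : cancel g f.
    move=> v; apply/rowP => i; rewrite mxE /g; case: cid => z /= zE.
    rewrite inner_sym zE (bigD1 i)//= eo eqxx mulr1 big1 ?addr0// => j ji.
    by rewrite eo eq_sym (negbTE ji) mulr0.
  exists g => // x; apply/(dist_eq0 mY).
  rewrite fD fg subrr /euclidean_norm big1 ?sqrtr0// => i _.
  by rewrite mxE expr0n.
Qed.

End MirrorSpace.

(** * Metrics of a Moebius structure *)

Section ProjEq.
Variable R : realType.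
Implicit Types a b c : R * R * R.

Lemma proj_eq_sym a b : proj_eq a b -> proj_eq b a.
Proof.
move=> [k [k0 [e1 e2 e3]]]; exists k^-1; rewrite invr_eq0; split=> //.
by rewrite e1 e2 e3 !mulKf.
Qed.

Lemma proj_eq_trans b a c : proj_eq a b -> proj_eq b c -> proj_eq a c.
Proof.
move=> [k [k0 [e1 e2 e3]]] [l [l0 [f1 f2 f3]]]; exists (k * l).
by rewrite mulf_neq0// e1 e2 e3 f1 f2 f3 !mulrA.
Qed.

Lemma proj_eq_ptolemy a b : proj_eq a b ->
  b.1.2 = b.1.1 + b.2 -> a.1.2 = a.1.1 + a.2.
Proof. by move=> [k [_ [-> -> ->]]] ->; rewrite mulrDr. Qed.

End ProjEq.

Section MobiusMetrics.
Variables (R : realType) (X : Type) (M : mobius_structure R X).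
Local Notation metrics := (mobius_metrics M).
Implicit Types d e : X -> X -> \bar R.

Lemma mobius_metrics_ext d : metrics d -> is_ext_metric d.
Proof. by have [d0 [_ ->]] := mobius_metricsP M; case. Qed.

Lemma mobius_metrics_equiv d e :
  metrics d -> metrics e -> mobius_equiv_metric d e.
Proof.
have [d0 [_ ->]] := mobius_metricsP M => -[_ dE] [_ eE] x y z u a.
exact: proj_eq_trans (proj_eq_sym (dE _ _ _ _ a)) (eE _ _ _ _ a).
Qed.

Lemma mobius_metrics_closed d e :
  metrics d -> is_ext_metric e -> mobius_equiv_metric d e -> metrics e.
Proof.
have [d0 [_ ->]] := mobius_metricsP M => -[_ dE] ee de; split=> // x y z u a.
exact: proj_eq_trans (dE _ _ _ _ a) (de _ _ _ _ a).
Qed.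

Lemma mobius_metrics_inhabited : exists d, metrics d.
Proof.
have [d0 [dm ->]] := mobius_metricsP M; exists d0; split=> // x y z u _.
by exists 1; rewrite oner_eq0 !mul1r.
Qed.

End MobiusMetrics.

(** Writing [c] for the distance with infinity replaced by [1], the entries of
a cross-ratio triple are products of values of [c], and [c] still vanishes
exactly on the diagonal. *)
Section Factors.
Variables (R : realType) (X : Type) (d : X -> X -> \bar R).
Hypothesis dm : is_ext_metric d.
Local Notation c x y := (cancel_infty (d x y)).

Lemma factor_ge0 x y : 0 <= c x y.
Proof. by have := ext_metric_ge0 dm x y; case: (d x y). Qed.

Lemma factor_sym x y : c x y = c y x.
Proof. by rewrite (ext_metric_sym dm). Qed.

Lemma factorxx x : c x x = 0.
Proof. by have /(ext_metric_eq0 dm) -> := erefl x. Qed.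

Lemma factor_eq0 x y : c x y = 0 <-> x = y.
Proof.
split=> [|->]; last exact: factorxx.
have := ext_metric_ge0 dm x y.
case E : (d x y) => [r||]//= _ => [r0|/eqP]; last by rewrite oner_eq0.
by apply/(ext_metric_eq0 dm); rewrite E r0.
Qed.

Lemma factor_gt0 x y : x <> y -> 0 < c x y.
Proof.
move=> xy; rewrite lt_neqAle factor_ge0 andbT; apply/eqP => /esym.
by move/factor_eq0.
Qed.

Lemma remote_factor w x : infinitely_remote d w -> x <> w -> c x w = 1.
Proof. by move=> dw xw; rewrite dw. Qed.

Lemma remote_dist w x y : infinitely_remote d w -> x <> w -> y <> w ->
  d x y = (c x y)%:E.
Proof.
move=> dw xw yw.
have [->|xy] := pselect (x = y).
  by have /(ext_metric_eq0 dm) -> := erefl y.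
suff : (d x y < +oo)%E.
  by have := ext_metric_ge0 dm x y; case: (d x y).
have [fin|[v [dv fin]]] := ext_metric_infty dm; first exact: fin.
have wv : v = w.
  apply: contrapT => /nesym vw; have [xv|xv] := pselect (x = v); last first.
    by have := fin x w xv vw; rewrite dw.
  have yv : y <> v by rewrite -xv; exact: nesym.
  by have := fin y w yv vw; rewrite dw.
by apply: fin; rewrite wv.
Qed.

End Factors.

(** * Moving a point to infinity *)

(** The metric of the structure with a prescribed infinitely remote point [z]:
its triangle inequality is the Ptolemy inequality for quadruples containing
[z]. *)
Section InvertedMetric.
Variables (R : realType) (X : Type) (M : mobius_structure R X).
Hypothesis Xptolemy : is_ptolemy M.
Variable d : X -> X -> \bar R.
Hypothesis Md : mobius_metrics M d.
Let dm := mobius_metrics_ext Md.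
Local Notation c x y := (cancel_infty (d x y)).

Lemma factor_ptolemy x y z u : c x z * c y u <= c x y * c z u + c x u * c y z.
Proof.
have cge0 := factor_ge0 dm; have cxx := factorxx dm.
have zero : c x z * c y u = 0 -> c x z * c y u <= c x y * c z u + c x u * c y z.
  by move=> ->; rewrite addr_ge0 ?mulr_ge0.
have [[xy yz]|nxyz] := pselect (x = y /\ y = z).
  by apply: zero; rewrite xy yz cxx mul0r.
have [[xy yu]|nxyu] := pselect (x = y /\ y = u).
  by apply: zero; rewrite -yu cxx mulr0.
have [[xz zu]|nxzu] := pselect (x = z /\ z = u).
  by apply: zero; rewrite xz cxx mul0r.
have [[yz zu]|nyzu] := pselect (y = z /\ z = u).
  by apply: zero; rewrite yz zu cxx mulr0.
by have [] := Xptolemy Md (And4 nxyz nxyu nxzu nyzu).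
Qed.

Definition inverted_metric (z x y : X) : \bar R :=
  if `[< x = y >] then 0%E else if `[< x = z \/ y = z >] then +oo%E else
  (c x y / (c x z * c y z))%:E.

Lemma inverted_metric_remote z : infinitely_remote (inverted_metric z) z.
Proof.
move=> x xz; rewrite /inverted_metric asboolF//.
by rewrite asboolT//; right.
Qed.

Lemma inverted_metric_finite z x y : x <> z -> y <> z ->
  inverted_metric z x y = (c x y / (c x z * c y z))%:E.
Proof.
move=> xz yz; rewrite /inverted_metric; case: asboolP => [->|xy].
  by rewrite (factorxx dm) mul0r.
by rewrite asboolF// => -[].
Qed.

Lemma inverted_metric_sym z x y : inverted_metric z x y = inverted_metric z y x.
Proof.
rewrite /inverted_metric (factor_sym dm x y) [c x z * _]mulrC.
have -> : `[< x = y >] = `[< y = x >] by apply: asbool_equiv_eq; split=> ->.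
have -> // : `[< x = z \/ y = z >] = `[< y = z \/ x = z >].
by apply: asbool_equiv_eq; split=> -[]; [right|left|right|left].
Qed.

Lemma inverted_metric_ext z : is_ext_metric (inverted_metric z).
Proof.
have cgt0 := factor_gt0 dm; have cge0 := factor_ge0 dm.
have ge0 x y : (0 <= inverted_metric z x y)%E.
  rewrite /inverted_metric; case: asboolP => // _; case: asboolP => // _.
  by rewrite lee_fin divr_ge0 ?mulr_ge0.
have xx x : inverted_metric z x x = 0%E.
  by rewrite /inverted_metric asboolT.
have nNy x y : inverted_metric z x y != -oo%E.
  by rewrite gt_eqF// (lt_le_trans _ (ge0 x y))// ltNy0.
have remote := @inverted_metric_remote z.
have fin := @inverted_metric_finite z.
split=> //.
- move=> x y; split=> [|->//].
  rewrite /inverted_metric; case: asboolP => // xy.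
  case: asboolP => // /not_orP[xz yz].
  move=> [] /eqP; rewrite mulf_eq0 invr_eq0 mulf_eq0.
  by rewrite !gt_eqF ?cgt0.
- exact: inverted_metric_sym.
- move=> x m y.
  have [->|xm] := pselect (x = m); first by rewrite xx add0e.
  have [->|my] := pselect (m = y); first by rewrite xx adde0.
  have [xz|xz] := pselect (x = z).
    have mz : m <> z by rewrite -xz; exact: nesym.
    by rewrite xz (inverted_metric_sym z z m) (remote m)// addye ?leey ?nNy.
  have [mz|mz] := pselect (m = z).
    by rewrite mz (remote x)// addye ?leey ?nNy.
  have [yz|yz] := pselect (y = z).
    by rewrite yz (remote m)// addey ?leey ?nNy.
  rewrite !fin// -EFinD lee_fin ler_pdivrMr ?mulr_gt0 ?cgt0//.
  have := factor_ptolemy x m y z; rewrite -(ler_pdivlMr _ _ (cgt0 _ _ mz)).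
  move=> /le_trans; apply; rewrite le_eqVlt; apply/orP; left; apply/eqP.
  by field; rewrite !gt_eqF ?cgt0.
- by right; exists z; split=> // x y xz yz; rewrite fin// ltry.
Qed.

(** The two distances differ by a factor [lam x * lam y], which cancels in
cross-ratios. The value [lam z = 1] makes this hold also for pairs containing
[z], whose new distance is infinite. *)
Lemma inverted_metric_mobius z : mobius_metrics M (inverted_metric z).
Proof.
apply: (mobius_metrics_closed Md); first exact: inverted_metric_ext.
have cgt0 := factor_gt0 dm.
pose lam x := if `[< x = z >] then 1 else c x z.
have lam0 x : lam x != 0.
  rewrite /lam; case: asboolP => [_|xz]; first exact: oner_neq0.
  by rewrite gt_eqF ?cgt0.
have E x y : c x y = lam x * lam y * cancel_infty (inverted_metric z x y).
  rewrite /lam; case: asboolP => [->|xz]; case: asboolP => [->|yz].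
  - by rewrite (factorxx dm) /inverted_metric asboolT// mulr0.
  - rewrite inverted_metric_sym inverted_metric_remote// mul1r mulr1.
    exact: factor_sym.
  - by rewrite inverted_metric_remote// !mulr1.
  - rewrite inverted_metric_finite//=; field.
    by rewrite !gt_eqF ?cgt0.
move=> x y t u _; exists (lam x * lam y * lam t * lam u).
by rewrite !mulf_neq0//; split=> //; split; rewrite /= !E; ring.
Qed.

End InvertedMetric.

Lemma remote_metric_exists (R : realType) (X : Type) (M : mobius_structure R X)
  (z : X) : is_ptolemy M ->
  exists2 d, mobius_metrics M d & infinitely_remote d z.
Proof.
move=> Xptolemy; have [d Md] := mobius_metrics_inhabited M.
exists (inverted_metric d z); first exact: inverted_metric_mobius.
exact: inverted_metric_remote.
Qed.

(** * The topology of a Moebius space *)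

(** The equivalence of compactness with the covering property is stated for
pointed spaces; [t0] serves as the point. *)
Lemma compact_finite_cover (T : topologicalType) (t0 : T) (A : set T) :
  compact A -> cover_compact A.
Proof.
pose pT : ptopologicalType := HB.pack T (isPointed.Build T t0).
by move=> cA; have : @compact pT A by []; rewrite compact_cover.
Qed.

Lemma uniq4P (T : eqType) (x y z u : T) : uniq [:: x; y; z; u] <->
  [/\ x <> y, x <> z & x <> u] /\ [/\ y <> z, y <> u & z <> u].
Proof.
rewrite !cons_uniq !inE !negb_or andbT -!andbA.
split=> [/and5P[/eqP ? /eqP ? /eqP ? /eqP ? /andP[/eqP ? /eqP ?]]//|].
by move=> [[/eqP-> /eqP-> /eqP->] [/eqP-> /eqP-> /eqP->]].
Qed.

Section MobiusTopology.
Variables (R : realType) (X : Type) (M : mobius_structure R X).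
Implicit Types d e : X -> X -> \bar R.

Lemma mobius_subbase_open (U : set (mobius_space M)) :
  mobius_subbase M U -> open U.
Proof.
move=> MU; exists [set U]; last by rewrite bigcup_set1.
by move=> _ ->; exact: finI_from1.
Qed.

Lemma mobius_space_continuous (phi : mobius_space M -> mobius_space M) :
  (forall U, mobius_subbase M U -> mobius_subbase M (phi @^-1` U)) ->
  continuous phi.
Proof.
move=> phiU; apply/continuousP => A [D DI <-].
rewrite preimage_bigcup; apply: bigcup_open => B /DI[F FD <-].
rewrite openE => x /= Fx.
rewrite /interior/= preimage_bigcap.
apply: filter_bigI => U UF; apply: open_nbhs_nbhs; split; last exact: Fx.
apply/mobius_subbase_open/phiU.
by have := FD _ UF; rewrite inE.
Qed.

(** The pullback of a metric of the structure by an automorphism is again a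
metric of the structure, so automorphisms permute the subbase. *)
Lemma mobius_automorphism_continuous (phi : mobius_space M -> mobius_space M) :
  mobius_automorphism M phi -> continuous phi.
Proof.
move=> [[psi psiK phiK] [inj mob]]; apply: mobius_space_continuous => U.
move=> [d [x [r [Md dx r0 UE]]]].
pose e a b := d (phi a) (phi b); have dm := mobius_metrics_ext Md.
have em : is_ext_metric e.
  split=> [a b|a b|a b|a b z|].
  - exact: (ext_metric_ge0 dm).
  - split=> [/(ext_metric_eq0 dm)/inj//|->]; exact/(ext_metric_eq0 dm).
  - exact: (ext_metric_sym dm).
  - exact: (ext_metric_triangle dm).
  have [fin|[w [dw fin]]] := ext_metric_infty dm.
    by left=> a b; exact: fin.
  have phiw a : a <> psi w -> phi a <> w.
    by move=> aw pa; apply: aw; rewrite -pa psiK.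
  right; exists (psi w); split=> [a aw|a b aw bw]; last first.
    by apply: fin; exact: phiw.
  by rewrite /e phiK; exact/dw/phiw.
have Me : mobius_metrics M e.
  apply: (mobius_metrics_closed Md em) => a b s t; exact: mob.
exists e, (psi x), r; split=> //.
  move=> ex; apply: dx => a ax; rewrite -(phiK a) -(phiK x).
  by apply: ex => /(can_inj phiK).
by case: UE => ->; [left|right]; rewrite /e phiK.
Qed.

Lemma connected_component_transport (T U : topologicalType) (f : T -> U)
    (A : set T) (B : set U) y u : continuous f -> f @` A `<=` B ->
  A y -> connected_component A y = connected_component A u ->
  connected_component B (f y) = connected_component B (f u).
Proof.
move=> fc fAB Ay yu; apply: same_connected_component.
exists (f @` connected_component A y).
  split.
  - by exists y => //; exact: connected_component_refl.
  - by move=> _ [p /connected_component_sub Ap <-]; apply: fAB; exists p.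
  - apply: connected_continuous_connected; first exact: component_connected.
    exact: continuous_subspaceT.
exists u => //; rewrite yu; apply: connected_component_refl.
apply: contrapT => nAu; have := connected_component_refl Ay.
by rewrite yu connected_component_out.
Qed.

(** Lines are moved around by s-inversions, which are involutions; hence the
hypothesis that [phi] is its own inverse. *)
Lemma ptolemy_circle_image (phi : mobius_space M -> mobius_space M)
    (sigma : set (mobius_space M)) :
  mobius_automorphism M phi -> (forall x, phi (phi x) = x) ->
  ptolemy_circle sigma -> ptolemy_circle (phi @` sigma).
Proof.
move=> phiM phiK [[f [g [fK gK fc gc]]] [d Md dP]].
have phic := mobius_automorphism_continuous phiM.
have im x : sigma x -> (phi @` sigma) (phi x) by exists x.
have im' x : (phi @` sigma) x -> sigma (phi x).
  by move=> [y sy <-]; rewrite phiK.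
split.
  pose a (x : set_type sigma) : set_type (phi @` sigma) :=
    exist _ (phi (sval x)) (mem_set (im _ (set_mem (svalP x)))).
  pose b (x : set_type (phi @` sigma)) : set_type sigma :=
    exist _ (phi (sval x)) (mem_set (im' _ (set_mem (svalP x)))).
  have aK : cancel a b by move=> x; apply/val_inj; rewrite /= phiK.
  have bK : cancel b a by move=> x; apply/val_inj; rewrite /= phiK.
  have ac : continuous a.
    apply: continuous_comp_initial => x.
    apply: (@continuous_comp _ _ _ set_val phi).
      exact: initial_continuous.
    exact: phic.
  have bc : continuous b.
    apply: continuous_comp_initial => x.
    apply: (@continuous_comp _ _ _ set_val phi).
      exact: initial_continuous.
    exact: phic.
  exists (f \o b), (a \o g); split.
  - exact: can_comp fK bK.
  - exact: can_comp aK gK.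
  - move=> x; apply: continuous_comp; [exact: bc|exact: fc].
  - move=> x; apply: continuous_comp; [exact: gc|exact: ac].
exists d => // x y z u sx sy sz su xyzu sep.
have phi_inj : injective phi by move=> p q /(congr1 phi); rewrite !phiK.
have adm : admissible x y z u.
  have /uniq4P[[xy xz _] [_ _ zu]] := xyzu.
  by split=> -[e1 e2]; [apply: xy|apply: xy|apply: xz|apply: zu].
apply: (proj_eq_ptolemy (phiM.2.2 d d Md Md x y z u adm)).
apply: dP; [exact: im'..| |].
  by rewrite (map_inj_uniq phi_inj [:: x; y; z; u]).
move=> E; apply: sep.
rewrite -(phiK y) -(phiK u).
apply: (connected_component_transport phic _ _ E).
  move=> _ [p [sp pxz] <-]; split; first exact: im.
  by move=> [] px; apply: pxz; [left|right]; rewrite -?px ?phiK -?px ?phiK.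
split; first exact: im'.
have /uniq4P[[xy _ _] [yz _ _]] := xyzu.
by move=> [/phi_inj /esym|/phi_inj].
Qed.

End MobiusTopology.

(** * Ptolemy circles through the remote point are lines *)

(** Stereographic coordinates of the unit circle; [circle_point_inv] is the
chart around the pole, with parameter [1/t]. *)
Section Stereographic.
Variable R : realType.

Definition circle_pole : R * R := (1, 0).
Definition circle_point (t : R) : R * R :=
  ((t ^+ 2 - 1) / (t ^+ 2 + 1), 2 * t / (t ^+ 2 + 1)).
Definition circle_point_inv (s : R) : R * R :=
  ((1 - s ^+ 2) / (1 + s ^+ 2), 2 * s / (1 + s ^+ 2)).

Lemma sqrD1_neq0 (t : R) : t ^+ 2 + 1 != 0.
Proof. by rewrite gt_eqF// ltr_wpDl// sqr_ge0. Qed.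

Lemma circle_poleP : unit_circle circle_pole.
Proof. by rewrite /unit_circle/= expr1n expr0n addr0. Qed.

Lemma circle_pointP t : unit_circle (circle_point t).
Proof. by rewrite /unit_circle/=; field; exact: sqrD1_neq0. Qed.

Lemma circle_point_invP s : unit_circle (circle_point_inv s).
Proof. by rewrite /unit_circle/=; field; rewrite addrC; exact: sqrD1_neq0. Qed.

Lemma circle_point_invE t : t != 0 -> circle_point_inv t^-1 = circle_point t.
Proof.
move=> t0; rewrite /circle_point_inv /circle_point.
have h := sqrD1_neq0 t.
by congr (_, _); field; rewrite t0 h.
Qed.

Lemma circle_pointE p : unit_circle p ->
  p = circle_pole \/ exists t, p = circle_point t.
Proof.
case: p => a b; rewrite /unit_circle/= => ab.
have [a1|a1] := eqVneq a 1.
  left; rewrite /circle_pole a1; congr (_, _); move: ab.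
  rewrite a1 expr1n => /eqP.
  by rewrite -subr_eq0 addrAC subrr add0r sqrf_eq0 => /eqP.
right; exists (b / (1 - a)); have a1' : 1 - a != 0 by rewrite subr_eq0 eq_sym.
have E : (b / (1 - a)) ^+ 2 = (1 + a) / (1 - a).
  rewrite expr_div_n; have -> : b ^+ 2 = (1 + a) * (1 - a) by lra.
  by field.
have two : 1 + a + (1 - a) != 0 :> R by rewrite addrACA subrr addr0 gt_eqF.
rewrite /circle_point E; congr (_, _); field; rewrite ?a1'//=.
Qed.

Lemma circle_point_neq_pole t : circle_point t <> circle_pole.
Proof.
move=> [] /(congr1 ( *%R^~ (t ^+ 2 + 1))); rewrite divfK ?sqrD1_neq0// mul1r.
by move=> h _; lra.
Qed.

Lemma circle_point_inj : injective circle_point.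
Proof.
move=> s t st; have h u : (circle_point u).2 / (1 - (circle_point u).1) = u.
  rewrite /=; have h := sqrD1_neq0 u; field.
  rewrite h/= !opprD opprK addrACA subrr add0r.
  by rewrite gt_eqF.
by rewrite -[s]h st h.
Qed.

Lemma circle_point_continuous : continuous circle_point.
Proof.
move=> t; have den : (fun u : R => (u ^+ 2 + 1)^-1) @ t --> (t ^+ 2 + 1)^-1.
  apply: cvgV; first exact: sqrD1_neq0.
  by apply: cvgD; [exact: exprn_continuous|exact: cvg_cst].
apply: (@cvg_pair _ _ _ (nbhs t) (nbhs (circle_point t).1)
  (nbhs (circle_point t).2) _ _ _ (fun u => (circle_point u).1)
  (fun u => (circle_point u).2)); apply: cvgM => //.
- by apply: cvgB; [exact: exprn_continuous|exact: cvg_cst].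
- by apply: cvgM; [exact: cvg_cst|exact: cvg_id].
Qed.

Lemma circle_point_inv_continuous : continuous circle_point_inv.
Proof.
move=> t; have den : (fun u : R => (1 + u ^+ 2)^-1) @ t --> (1 + t ^+ 2)^-1.
  apply: cvgV; first by rewrite addrC; exact: sqrD1_neq0.
  by apply: cvgD; [exact: cvg_cst|exact: exprn_continuous].
apply: (@cvg_pair _ _ _ (nbhs t) (nbhs (circle_point_inv t).1)
  (nbhs (circle_point_inv t).2) _ _ _ (fun u => (circle_point_inv u).1)
  (fun u => (circle_point_inv u).2)); apply: cvgM => //.
- by apply: cvgB; [exact: cvg_cst|exact: exprn_continuous].
- by apply: cvgM; [exact: cvg_cst|exact: cvg_id].
Qed.

(** An affine function whose zeros on the circle are the points of parameters
[a] and [c]: in stereographic coordinates it is [(t - a) * (t - c)] up to a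
positive factor. *)
Definition chord (a c : R) (p : R * R) : R :=
  (1 + p.1) - (a + c) * p.2 + a * c * (1 - p.1).

Lemma chord_pole a c : chord a c circle_pole = 2.
Proof. by rewrite /chord/=; ring. Qed.

Lemma chord_point a c t :
  chord a c (circle_point t) = 2 * ((t - a) * (t - c)) / (t ^+ 2 + 1).
Proof. by rewrite /chord/=; field; exact: sqrD1_neq0. Qed.

Lemma chord_continuous a c : continuous (chord a c).
Proof.
move=> p; apply: cvgD; first apply: cvgB.
- by apply: cvgD; [exact: cvg_cst|exact: cvg_fst].
- by apply: cvgM; [exact: cvg_cst|exact: cvg_snd].
- apply: cvgM; first exact: cvg_cst.
  by apply: cvgB; [exact: cvg_cst|exact: cvg_fst].
Qed.

End Stereographic.

Section CircleToLine.
Variables (R : realType) (X : Type) (M : mobius_structure R X).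
Variable sigma : set (mobius_space M).
Hypothesis circle : ptolemy_circle sigma.

(** A parametrization of a circle minus one of its points [w]. For [a < b < c]
the points of parameters [b] and [w] are in different components of the circle
cut at [a] and [c], because [chord] has opposite signs at them, and a connected
set on which it changes sign contains one of the two cut points. *)
Lemma ptolemy_circle_parametrization :
  exists (w : mobius_space M) (gam : R -> mobius_space M),
  [/\ sigma = [set w] `|` range gam, injective gam, forall t, gam t <> w,
      continuous gam &
      (forall U, open U -> U w -> exists A, forall t, A < `|t| -> U (gam t)) /\
      (forall d a b c, mobius_metrics M d -> a < b -> b < c ->
        let: (p, q, r) := crt d (gam a) (gam b) (gam c) w in q = p + r)].
Proof.
have [[f [g [fK gK fc gc]]] [d0 Md0 dP]] := circle.
pose G p (pc : unit_circle p) : mobius_space M :=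
  sval (g (exist _ p (mem_set pc))).
have Gs p pc : sigma (@G p pc) by apply: set_mem; exact: (svalP (g _)).
have GE p q pc qc : p = q -> @G p pc = @G q qc.
  by move=> pq; subst q; rewrite (Prop_irrelevance pc qc).
have Ginj p q pc qc : @G p pc = @G q qc -> p = q.
  move=> /val_inj /(can_inj gK) /(congr1 val); exact.
have Gsurj x : sigma x -> exists p pc, x = @G p pc.
  move=> sx; pose s : set_type sigma := exist _ x (mem_set sx).
  exists (sval (f s)), (set_mem (svalP (f s))).
  rewrite /G; set e := exist _ _ _.
  have -> : e = f s by exact/val_inj.
  by rewrite fK.
have Gc (P : R -> R * R) (Pc : forall t, unit_circle (P t)) : continuous P ->
    continuous (fun t => @G (P t) (Pc t)).
  move=> cP.
  pose h t : set_type (@unit_circle R) := exist _ (P t) (mem_set (Pc t)).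
  have hc : continuous h by apply: continuous_comp_initial; exact: cP.
  move=> t; apply: (@continuous_comp _ _ _ (g \o h) set_val).
    apply: continuous_comp; [exact: hc|exact: gc].
  exact: initial_continuous.
pose w := G _ (circle_poleP R); pose gam t := G _ (circle_pointP t).
exists w, gam; split.
- rewrite eqEsubset; split=> x.
    move=> /Gsurj[p [pc ->]].
    have [pE|[t pE]] := circle_pointE pc; first by left; exact: GE.
    by right; exists t => //; exact: GE.
  by move=> [->|[t _ <-]]; exact: Gs.
- by move=> s t /Ginj /circle_point_inj.
- by move=> t /Ginj /circle_point_neq_pole.
- exact/Gc/circle_point_continuous.
split=> [U oU Uw|d a b c Md ab bc].
  pose h s := G _ (circle_point_invP s).
  have h0 : h 0 = w.
    apply: GE; rewrite /circle_point_inv expr0n/= subr0 addr0 divr1.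
    by rewrite mulr0 mul0r.
  have hc : continuous h by exact/Gc/circle_point_inv_continuous.
  have : nbhs (0 : R) (h @^-1` U).
    by apply: hc; rewrite h0; exact: open_nbhs_nbhs.
  move=> /nbhs_ballP[e /= e0 eU]; exists e^-1 => t et.
  have t0 : 0 < `|t| by apply: lt_trans et; rewrite invr_gt0.
  have tn : t != 0 by rewrite -normr_gt0.
  suff -> : gam t = h t^-1.
    apply: eU; rewrite /ball/= sub0r normrN normfV.
    by rewrite invf_plt.
  by apply: GE; rewrite circle_point_invE.
suff : let: (p, q, r) := crt d0 (gam a) (gam b) (gam c) w in q = p + r.
  have adm : admissible (gam a) (gam b) (gam c) w.
    have gn s t : s < t -> gam s <> gam t.
      by move=> st /Ginj /circle_point_inj E; move: st; rewrite E ltxx.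
    have gw t : gam t <> w by move=> /Ginj /circle_point_neq_pole.
    by split=> -[e1 e2]; [exact: (gn _ _ ab)|exact: (gn _ _ ab)|
      exact: (gw _ e2)|exact: (gw _ e2)].
  exact: (proj_eq_ptolemy (mobius_metrics_equiv Md Md0 adm)).
apply: dP; [exact: Gs..| |].
  apply/uniq4P; have gw t : gam t <> w by move=> /Ginj /circle_point_neq_pole.
  have gn s t : s < t -> gam s <> gam t.
    by move=> st /Ginj /circle_point_inj E; move: st; rewrite E ltxx.
  by split; split=> //; apply: gn => //; exact: lt_trans bc.
pose L (x : set_type sigma) := chord a c (val (f x)).
have Lc : continuous L.
  move=> x; apply: (@continuous_comp _ _ _ f (chord a c \o set_val)).
    exact: fc.
  apply: continuous_comp; first exact: initial_continuous.
  exact: chord_continuous.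
(* [L] extended by [0] outside of [sigma]. *)
pose V := valL_ 0 L.
have Vc : {within sigma, continuous V} by apply/subspace_valL_continuousP'.
have VS (s : set_type sigma) : V (sval s) = L s :=
  congr1 (fun h => h s) (valLK 0 L).
have VG p pc : V (@G p pc) = chord a c p by rewrite /G VS /L gK.
have gw t : gam t <> w by move=> /Ginj /circle_point_neq_pole.
have gn s t : s < t -> gam s <> gam t.
  by move=> st /Ginj /circle_point_inj E; move: st; rewrite E ltxx.
set A := sigma `\` _; have Ab : A (gam b).
  by split; [exact: Gs|move=> [/esym|]; exact: gn].
have Aw : A w by split; [exact: Gs|move=> [/esym|/esym]; exact: gw].
set C := connected_component A (gam b) => E.
have Cb : C (gam b) by exact: connected_component_refl.
have Cw : C w by rewrite E; exact: connected_component_refl.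
have /connected_intervalP IC : connected (V @` C).
  apply: connected_continuous_connected; first exact: component_connected.
  by apply: continuous_subspaceW Vc => x /connected_component_sub[].
have [x Cx Vx] : (V @` C) 0.
  apply: (IC (V (gam b)) (V w)); [by exists (gam b)|by exists w|].
  rewrite !VG chord_pole chord_point ler0n andbT.
  rewrite pmulr_lle0 ?invr_gt0 ?ltr_wpDl ?sqr_ge0// pmulr_rle0//.
  by rewrite pmulr_rle0 ?subr_gt0// subr_le0 ltW.
have [/Gsurj[p [pc xE]] nx] := connected_component_sub Cx.
move: Vx; rewrite xE VG.
have [pE|[t pE]] := circle_pointE pc; rewrite pE.
  by rewrite chord_pole => /eqP; rewrite pnatr_eq0.
rewrite chord_point => /eqP; rewrite !mulf_eq0 pnatr_eq0/= invr_eq0.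
rewrite (negbTE (sqrD1_neq0 t)) orbF !subr_eq0 => /orP tac.
apply: nx; rewrite xE.
by case: tac => /eqP tE; [left|right]; apply: GE; rewrite pE tE.
Qed.

End CircleToLine.

Section RemoteMetric.
Variables (R : realType) (X : Type) (M : mobius_structure R X).
Variables (d : X -> X -> \bar R) (w : X).
Hypothesis Md : mobius_metrics M d.
Hypothesis dw : infinitely_remote d w.
Let dm := mobius_metrics_ext Md.
Local Notation c x y := (cancel_infty (d x y)).

Lemma not_remote x y : x <> w -> y <> w -> x <> y -> ~ infinitely_remote d x.
Proof.
move=> xw yw xy /(_ y (nesym xy)).
by rewrite (remote_dist dm dw yw xw).
Qed.

Lemma open_ball x y r : x <> w -> y <> w -> x <> y -> 0 < r ->
  open ([set z | (d x z < r%:E)%E] : set (mobius_space M)).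
Proof.
move=> xw yw xy r0; apply: mobius_subbase_open; exists d, x, r; split=> //.
  exact: not_remote yw xy.
by left.
Qed.

Lemma open_coball x y r : x <> w -> y <> w -> x <> y -> 0 < r ->
  open (~` [set z | (d x z <= r%:E)%E] : set (mobius_space M)).
Proof.
move=> xw yw xy r0; apply: mobius_subbase_open; exists d, x, r; split=> //.
  exact: not_remote yw xy.
by right.
Qed.

Lemma coball_remote x r : x <> w -> (~` [set z | (d x z <= r%:E)%E]) w.
Proof. by move=> xw /=; rewrite dw. Qed.

(** Parametrization by the signed distance to [gam 0]. It is onto [R] since the
complements of large balls are neighbourhoods of [w], which [gam] enters at
both ends. *)
Lemma arclength_line (gam : R -> mobius_space M) :
  injective gam -> (forall t, gam t <> w) -> continuous gam ->
  (forall U : set (mobius_space M), open U -> U w ->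
     exists A, forall t, A < `|t| -> U (gam t)) ->
  (forall a b e, a < b -> b < e ->
     c (gam a) (gam e) = c (gam a) (gam b) + c (gam b) (gam e)) ->
  exists l : R -> X, (forall s t, c (l s) (l t) = `|s - t|) /\
    range l = range gam.
Proof.
move=> ginj gw gc gunb gadd.
have gn t : gam t <> gam (t + 1).
  by move=> /ginj /eqP; rewrite -subr_eq0 opprD addNKr oppr_eq0 oner_eq0.
pose F t := if 0 <= t then c (gam 0) (gam t) else - c (gam 0) (gam t).
have FB s t : s < t -> F t - F s = c (gam s) (gam t).
  move=> st; rewrite /F.
  have [t0|t0] := leP 0 t; have [s0|s0] := leP 0 s.
  - move: s0; rewrite le_eqVlt => /orP[/eqP<-|s0].
      by rewrite (factorxx dm) subr0.
    by rewrite (gadd _ _ _ s0 st) addrAC subrr add0r.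
  - rewrite opprK; move: t0; rewrite le_eqVlt => /orP[/eqP<-|t0].
      by rewrite (factorxx dm) add0r (factor_sym dm).
    by rewrite (gadd _ _ _ s0 t0) addrC (factor_sym dm (gam s)).
  - by move: (lt_trans st t0); rewrite ltNge s0.
  - rewrite (factor_sym dm _ (gam t)) (factor_sym dm _ (gam s)).
    by rewrite (gadd _ _ _ st t0) opprK addrC addrK.
have Fdist s t : `|F s - F t| = c (gam s) (gam t).
  have [st|st|->] := ltgtP s t.
  - by rewrite distrC FB// ger0_norm// (factor_ge0 dm).
  - by rewrite FB// ger0_norm ?(factor_ge0 dm)// (factor_sym dm).
  - by rewrite subrr normr0 (factorxx dm).
have Finj s t : F s = F t -> s = t.
  move=> st; apply/ginj/(factor_eq0 dm).
  by rewrite -Fdist st subrr normr0.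
have Fc : continuous F.
  move=> t; apply/cvgrPdist_lt => e e0.
  have Bt : nbhs (gam t) [set z | (d (gam t) z < e%:E)%E].
    apply: open_nbhs_nbhs; split; first exact: (open_ball (gw _) (gw _) (gn t)).
    by rewrite /= (ext_metric_eq0 dm (gam t) (gam t)).2.
  have : \forall s \near t, (d (gam t) (gam s) < e%:E)%E by exact: (gc t _ Bt).
  apply: filterS => s /=.
  by rewrite (remote_dist dm dw (gw _) (gw _)) lte_fin Fdist.
have Fbig r : 0 < r -> exists2 A, 0 < A & r < F A /\ F (- A) < - r.
  move=> r0; have [A AP] := gunb _ (open_coball (gw _) (gw _) (gn 0) r0)
    (coball_remote (r := r) (gw 0)).
  pose B := `|A| + 1; have B0 : 0 < B by rewrite ltr_wpDl.
  have AB : A < B by rewrite ltr_pwDr// ler_norm.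
  exists B => //; have big t : `|t| = B -> r < c (gam 0) (gam t).
    move=> tB; have := AP t; rewrite tB => /(_ AB)/=.
    rewrite (remote_dist dm dw (gw _) (gw _)) lee_fin => /negP.
    by rewrite -ltNge.
  rewrite /F ltW// oppr_ge0 leNgt B0/= ltrN2.
  by split; apply: big; rewrite ?normrN gtr0_norm.
have Fsurj r : exists t, F t = r.
  have [|A A0 [FA FNA]] := Fbig (`|r| + 1); first by rewrite ltr_wpDl.
  have [|||t _ tr] := @IVT _ F (- A) A r; last by exists t.
  - by lra.
  - exact: continuous_subspaceT.
  - have := ler_norm r; have := ler_norm (- r); rewrite normrN => h1 h2.
    rewrite ge_min le_max; apply/andP; split; apply/orP; [left|right]; lra.
pose G r := sval (cid (Fsurj r)); have GK r : F (G r) = r.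
  by rewrite /G; case: cid.
exists (gam \o G); split=> [s t|]; first by rewrite /= -Fdist !GK.
rewrite eqEsubset; split=> x [t _ <-]; first by exists (G t).
by exists (F t) => //=; congr gam; apply: Finj; rewrite GK.
Qed.

End RemoteMetric.

Lemma ptolemy_circle_line (R : realType) (X : Type) (M : mobius_structure R X)
    (sigma : set (mobius_space M)) :
  ptolemy_circle sigma -> exists w, forall d : X -> X -> \bar R,
  mobius_metrics M d -> infinitely_remote d w ->
  exists l : R -> X, [/\ forall s, l s <> w,
    forall s t, cancel_infty (d (l s) (l t)) = `|s - t| &
    sigma = [set w] `|` range l].
Proof.
move=> /ptolemy_circle_parametrization[w [gam [sE ginj gw gc [gunb gadd]]]].
exists w => d Md dw.
have gadd' a b e : a < b -> b < e -> cancel_infty (d (gam a) (gam e)) =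
    cancel_infty (d (gam a) (gam b)) + cancel_infty (d (gam b) (gam e)).
  move=> ab be; have := gadd d a b e Md ab be.
  by rewrite /crt !(dw _ (gw _))/= !mulr1 mul1r.
have [l [liso lE]] := arclength_line Md dw ginj gw gc gunb gadd'.
exists l; split=> //; last by rewrite lE.
move=> s; have : range l (l s) by exists s.
by rewrite lE => -[t _ <-].
Qed.

(** * Reflections and inversions from s-inversions *)

(** The first equation leaves the two values [r^2/s] and [- r^2/s] for [v]; the
second one, the distance to the fixed point [r], excludes the latter. *)
Lemma inversion_parameter (R : realType) (r s v : R) : 0 < r -> s != 0 ->
  `|v| = r ^+ 2 / `|s| -> `|v - r| = r * `|s - r| / `|s| -> v = r ^+ 2 / s.
Proof.
move=> r0 s0 v1 v2; have r2 : 0 < r ^+ 2 by rewrite exprn_gt0.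
have : `|v| = `|r ^+ 2 / s| by rewrite v1 normrM normfV gtr0_norm.
move=> /eqP; rewrite eqr_norm2 => /orP[/eqP//|/eqP vE].
have : `|s + r| = `|s - r|.
  have : `|v - r| * `|s| / r = `|s - r|.
    by rewrite v2 divfK ?normr_eq0// mulrC mulKf// gt_eqF.
  move=> <-; have -> : v - r = - (r / s * (s + r)).
    by rewrite vE; field.
  rewrite normrN !normrM normfV (gtr0_norm r0); field.
  by rewrite normr_eq0 s0 gt_eqF.
move=> /eqP; rewrite eqr_norm2 => /orP[] /eqP E; first lra.
have s00 : s = 0 by lra.
by rewrite s00 eqxx in s0.
Qed.

Section RemotePoint.
Variables (R : realType) (X : Type) (M : mobius_structure R X).
Hypotheses (Xptolemy : is_ptolemy M) (XsI : property_sI M).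
Variables (d : X -> X -> \bar R) (w : X).
Hypothesis Md : mobius_metrics M d.
Hypothesis dw : infinitely_remote d w.
Let dm := mobius_metrics_ext Md.
Local Notation c x y := (cancel_infty (d x y)).
Let csym := factor_sym dm.
Let cgt0 := factor_gt0 dm.
Let cw x : x <> w -> c x w = 1. Proof. exact: remote_factor. Qed.
Let cw' x : x <> w -> c w x = 1. Proof. by rewrite csym; exact: cw. Qed.

Let admissible_distinct (x y z u : X) :
  x <> y -> x <> z -> z <> u -> admissible x y z u.
Proof.
by move=> xy xz zu; split=> -[e1 e2];
  [apply: xy|apply: xy|apply: xz|apply: zu].
Qed.

(** With respect to the metric with remote point [q], the sphere around [p]
through [w] is the bisector of [p] and [q]. The cross-ratios of quadruples
containing the fixed point [w] show that [phi] multiplies all distances by one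
constant, which is [1] because [p] and [q] are exchanged. *)
Lemma mobius_reflection p q : p <> w -> q <> w -> p <> q -> exists phi : X -> X,
  [/\ mobius_automorphism M phi, forall x, phi (phi x) = x,
   phi p = q, phi w = w &
   [/\ forall x, x <> w -> c x p = c x q -> phi x = x,
       forall x y, x <> w -> y <> w -> c (phi x) (phi y) = c x y &
       forall sigma : set (mobius_space M), ptolemy_circle sigma ->
         sigma p -> sigma q -> phi @` sigma = sigma]].
Proof.
move=> pw qw pq; pose e := inverted_metric d q.
pose S := [set x | e x p = ((c p q)^-1)%:E].
have cpq0 := cgt0 pq.
have [|phi [phiM [phiK phip fixed circ]]] := XsI pq (S := S).
  exists e, (c p q)^-1; split=> //.
  - exact: inverted_metric_mobius.
  - exact: inverted_metric_remote.
  - by rewrite invr_gt0.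
have phiw : phi w = w.
  apply: fixed.
  rewrite /S/= /e (inverted_metric_finite Md) //; last exact: nesym.
  by rewrite !cw'// !mul1r.
have fix_bis x : x <> w -> c x p = c x q -> phi x = x.
  move=> xw xpq; apply: fixed.
  have xq : x <> q.
    move=> xq; move: xpq; rewrite xq (factorxx dm) => /(factor_eq0 dm) qp.
    exact: pq.
  rewrite /S/= /e (inverted_metric_finite Md)// xpq; congr EFin; field.
  by rewrite !gt_eqF// cgt0.
have inj : injective phi by move=> x y /(congr1 phi); rewrite !phiK.
have phinw x : x <> w -> phi x <> w by move=> xw; rewrite -phiw => /inj.
exists phi; split=> //; split=> //.
have tri x y z : x <> w -> y <> w -> z <> w -> x <> y -> x <> z ->
    exists k, [/\ c x y = k * c (phi x) (phi y), c x z = k * c (phi x) (phi z)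
      & c y z = k * c (phi y) (phi z)].
  move=> xw yw zw xy xz.
  have [k [_ []]] := phiM.2.2 d d Md Md x y z w (admissible_distinct xy xz zw).
  rewrite /crt/= phiw !cw//; try exact: phinw.
  by rewrite !mulr1 !mul1r => k1 k2 k3; exists k.
have one k x y : x <> y -> c (phi x) (phi y) = c x y ->
    c x y = k * c (phi x) (phi y) -> k = 1.
  move=> xy -> /eqP; rewrite -subr_eq0 -{1}[c x y]mul1r -mulrBl mulf_eq0.
  by rewrite (gt_eqF (cgt0 xy)) orbF subr_eq0 => /eqP.
(* The pair exchanged by [phi] fixes the ratio [k], first for pairs containing
   [p], then for all pairs. *)
have isopq : c (phi p) (phi q) = c p q by rewrite -phip phiK csym.
have isop z : z <> w -> c (phi p) (phi z) = c p z.
  move=> zw; have [<-|pz] := pselect (p = z).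
    by rewrite !(factorxx dm).
  have [k [k1 k2 _]] := tri p q z pw qw zw pq pz.
  by rewrite k2 (one _ _ _ pq isopq k1) mul1r.
move=> x y xw yw; have [<-|px] := pselect (p = x); first exact: isop.
have [<-|py] := pselect (p = y); first by rewrite csym isop.
have [k [k1 _ k3]] := tri p x y pw xw yw px py.
by rewrite k3 (one _ _ _ px (isop x xw) k1) mul1r.
Qed.

(** Cross-ratios of quadruples [(x, y, o, w)] express the distances between
images through the number [c x o * c (phi x) o], which does not depend on [x];
the fixed point [y0] on the sphere shows that it equals [r^2]. *)
Lemma mobius_inversion o y0 r : o <> w -> y0 <> w -> 0 < r -> c y0 o = r ->
  exists phi : X -> X,
  [/\ forall x, x <> o -> x <> w -> phi x <> o /\ phi x <> w,
      forall x, x <> w -> c x o = r -> phi x = x,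
      forall x, x <> o -> x <> w -> c (phi x) o = r ^+ 2 / c x o,
      forall x y, x <> o -> x <> w -> y <> o -> y <> w ->
        c (phi x) (phi y) = r ^+ 2 * c x y / (c x o * c y o) &
      forall (sigma : set (mobius_space M)) x, ptolemy_circle sigma ->
        sigma o -> sigma w -> sigma x -> sigma (phi x)].
Proof.
move=> ow y0w r0 y0r; pose S := [set x | d x o = r%:E].
have [|phi [phiM [phiK phio fixed circ]]] := XsI ow (S := S).
  by exists d, r; split.
have phiw : phi w = o by rewrite -phio phiK.
have inj : injective phi by move=> x y /(congr1 phi); rewrite !phiK.
have phin x : x <> o -> x <> w -> phi x <> o /\ phi x <> w.
  by move=> xo xw; split; [rewrite -phiw => /inj|rewrite -phio => /inj].
have fix_sphere x : x <> w -> c x o = r -> phi x = x.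
  by move=> xw xr; apply: fixed; rewrite /S/= (remote_dist dm dw xw ow) xr.
have phiy0 := fix_sphere _ y0w y0r.
have y0o : y0 <> o.
  by move=> y0o; move: r0; rewrite -y0r y0o (factorxx dm) ltxx.
have tri x y : x <> o -> x <> w -> y <> o -> y <> w -> x <> y ->
    exists k, [/\ c x y = k * c (phi x) (phi y), c x o = k * c (phi y) o
      & c y o = k * c (phi x) o].
  move=> xo xw yo yw xy.
  have [k [_ []]] := phiM.2.2 d d Md Md x y o w (admissible_distinct xy xo ow).
  have [pxo pxw] := phin _ xo xw; have [pyo pyw] := phin _ yo yw.
  rewrite /crt/= phio phiw !cw// cw'//.
  by rewrite !mulr1 !mul1r => k1 k2 k3; exists k.
have rad x : x <> o -> x <> w -> c (phi x) o = r ^+ 2 / c x o.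
  move=> xo xw; have xo0 := cgt0 xo.
  have [->|xy0] := pselect (x = y0).
    by rewrite phiy0 y0r expr2 mulfK// gt_eqF.
  have [k [_ k2 k3]] := tri x y0 xo xw y0o y0w xy0.
  rewrite phiy0 y0r in k2; rewrite y0r in k3.
  have k0 : k != 0 by apply: contraTneq r0 => k0; rewrite k3 k0 mul0r ltxx.
  have -> : c (phi x) o = r / k by rewrite {1}k3 mulrC mulKf.
  by rewrite k2; field; rewrite k0 gt_eqF.
exists phi; split=> //; last first.
  by move=> sigma x sc so sw sx; rewrite -(circ sigma sc so sw); exists x.
move=> x y xo xw yo yw; have [->|xy] := pselect (x = y).
  by rewrite !(factorxx dm) mulr0 mul0r.
have [k [k1 k2 _]] := tri x y xo xw yo yw xy.
have k0 : k != 0 by apply: contraTneq (cgt0 xo) => k0; rewrite k2 k0 mul0r ltxx.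
rewrite k1 k2 (rad y yo yw); field.
by rewrite k0 !gt_eqF ?cgt0.
Qed.

(** * The complement of the remote point is a mirror space *)

Definition finite_point := {x : X | x <> w}.
Definition finite_dist (x y : finite_point) : R := c (sval x) (sval y).
Definition ptolemy_line (l : R -> finite_point) : Prop :=
  (forall s t, finite_dist (l s) (l t) = `|s - t|) /\
  ptolemy_circle
    ([set w] `|` range (fun s => sval (l s)) : set (mobius_space M)).
Local Notation D := finite_dist.

Lemma finite_point_eq (x y : finite_point) : sval x = sval y -> x = y.
Proof. by case: x y => [x xw] [y yw] /= E; exact: eq_exist. Qed.

Lemma finite_distE (x y : finite_point) :
  d (sval x) (sval y) = (finite_dist x y)%:E.
Proof. exact: (remote_dist dm dw (svalP x) (svalP y)). Qed.

Lemma ptolemy_line_reparam l (f g : R -> R) : cancel f g -> cancel g f ->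
  (forall s t, `|f s - f t| = `|s - t|) ->
  ptolemy_line l -> ptolemy_line (l \o f).
Proof.
move=> fK gK fiso [liso lc]; split=> [s t|]; first by rewrite /= liso fiso.
suff -> : range (fun s => sval ((l \o f) s)) =
  range (fun s => sval (l s)) by [].
rewrite eqEsubset; split=> x [t _ <-] /=; first by exists (f t).
by exists (g t); rewrite //= gK.
Qed.

Lemma finite_reflection (p q : finite_point) : p <> q ->
  exists phi : finite_point -> finite_point,
    [/\ forall x y, D (phi x) (phi y) = D x y,
        phi p = q,
        forall x, D x p = D x q -> phi x = x,
        forall l, ptolemy_line l -> ptolemy_line (phi \o l) &
        forall l a b, ptolemy_line l -> l a = p -> l b = q ->
          forall s, phi (l s) = l (a + b - s)].
Proof.
move=> pq; have pq' : sval p <> sval q by move=> /finite_point_eq.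
have [phi [phiM phiK phip phiw [fixed iso circ]]] :=
  mobius_reflection (svalP p) (svalP q) pq'.
have phinw x : x <> w -> phi x <> w.
  by move=> xw pxw; apply: xw; rewrite -(phiK x) pxw.
pose psi (x : finite_point) : finite_point :=
  exist (fun x => x <> w) _ (phinw _ (svalP x)).
have psi_iso x y : D (psi x) (psi y) = D x y.
  exact: iso (svalP x) (svalP y).
have psip : psi p = q by exact: finite_point_eq.
exists psi; split=> //.
- by move=> x xpq; apply: finite_point_eq; exact: fixed (svalP x) xpq.
- move=> l [liso lc]; split=> [s t|]; first by rewrite /= psi_iso.
  have := ptolemy_circle_image phiM phiK lc; congr (ptolemy_circle _).
  by rewrite image_setU image_set1 phiw image_comp.
- move=> l a b [liso lc] la lb s.
  have [t lt] : exists t, psi (l s) = l t.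
    have E := circ _ lc.
    have : ([set w] `|` range (fun s => sval (l s))) (phi (sval (l s))).
      rewrite -E; last 2 first.
      - by right; exists a; rewrite ?la.
      - by right; exists b; rewrite ?lb.
      by exists (sval (l s)) => //; right; exists s.
    move=> [/(phinw _ (svalP (l s)))//|[t _ tE]].
    by exists t; exact: finite_point_eq.
  have psiq : psi q = p by apply: finite_point_eq; rewrite -psip/= phiK.
  have ab : a - b != 0.
    by rewrite subr_eq0; apply/eqP => ab; apply: pq; rewrite -la -lb ab.
  have e1 : `|t - b| = `|s - a|.
    by rewrite -!liso -lt la lb -psip psi_iso.
  have e2 : `|t - a| = `|s - b|.
    by rewrite -!liso -lt la lb -{1}psiq psi_iso.
  rewrite lt; congr l.
  have sq (u v : R) : `|u| = `|v| -> u ^+ 2 = v ^+ 2.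
    by move=> uv; rewrite -[LHS]real_normK ?num_real// uv real_normK ?num_real.
  have := sq _ _ e1; have := sq _ _ e2 => h1 h2.
  have : (a - b) * (t + s - (a + b)) = 0 by lra.
  move=> /eqP; rewrite mulf_eq0 (negbTE ab)/= => /eqP h; lra.
Qed.

Hypothesis line0 : exists l, ptolemy_line l.

(** The inversion preserves every line through its centre, and its action on
such a line is determined by [inversion_parameter]. *)
Lemma finite_inversion_lines l m a b k s u : ptolemy_line l -> ptolemy_line m ->
  l a = m b -> 0 < k -> s != 0 -> u != 0 ->
  D (l (a + k / s)) (m (b + k / u)) =
    k * D (l (a + s)) (m (b + u)) / (`|s| * `|u|).
Proof.
move=> Ll Lm lm k0 s0 u0.
pose r := Num.sqrt k; have r0 : 0 < r by rewrite sqrtr_gt0.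
have kr : k = r ^+ 2 by rewrite sqr_sqrtr ?ltW.
pose o := sval (l a).
have y0r : c (sval (l (a + r))) o = r.
  by rewrite -[LHS]/(D _ _) Ll.1 addrC addKr gtr0_norm.
have [phi [phin fixed rad phiD circ]] :=
  mobius_inversion (svalP (l a)) (svalP (l (a + r))) r0 y0r.
have off n e t : ptolemy_line n -> sval (n e) = o -> t != 0 ->
    sval (n (e + t)) <> o /\ c (sval (n (e + t))) o = `|t|.
  move=> [niso _] ne t0; have E : c (sval (n (e + t))) o = `|t|.
    by rewrite -ne -[LHS]/(D _ _) niso addrC addKr.
  split=> // no; move: E; rewrite no (factorxx dm) => /esym/eqP.
  by rewrite normr_eq0 (negbTE t0).
have act n e t : ptolemy_line n -> sval (n e) = o -> t != 0 ->
    phi (sval (n (e + t))) = sval (n (e + k / t)).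
  move=> Ln ne t0; have [xo xE] := off _ _ _ Ln ne t0.
  have rn : r != 0 by rewrite gt_eqF.
  have [yo yE] := off _ _ _ Ln ne rn; rewrite gtr0_norm// in yE.
  have [_ pxw] := phin _ xo (svalP (n (e + t))).
  have [pw|[v _ vE]] := circ _ (sval (n (e + t))) Ln.2
    (or_intror (ex_intro2 _ _ e I ne)) (or_introl erefl)
    (or_intror (ex_intro2 _ _ (e + t) I erefl)).
    by [].
  rewrite -vE; congr (sval (n _)); apply: (addrI (- e)); rewrite addKr addrC kr.
  have vo : c (phi (sval (n (e + t)))) o = `|v - e|.
    by rewrite -vE -ne -[LHS]/(D _ _) Ln.1.
  apply: inversion_parameter => //.
    by rewrite -vo rad ?xE//; exact: (svalP (n (e + t))).
  have := phiD _ _ xo (svalP (n (e + t))) yo (svalP (n (e + r))).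
  rewrite (fixed _ (svalP (n (e + r))) yE) -vE xE yE -![c _ _]/(D _ _) !Ln.1.
  rewrite !opprD !addrA (addrAC e) subrr add0r => ->.
  by field; rewrite normr_eq0 t0.
have mo : sval (m b) = o by rewrite -lm.
have [xo xE] := off _ _ _ Ll erefl s0; have [yo yE] := off _ _ _ Lm mo u0.
rewrite /D -(act _ _ _ Ll erefl s0) -(act _ _ _ Lm mo u0).
rewrite phiD ?xE ?yE -?kr//; first exact: (svalP (l (a + s))).
exact: (svalP (m (b + u))).
Qed.

Lemma finite_mirror_space : mirror_space D ptolemy_line.
Proof.
split.
- by move=> x y; exact: factor_ge0.
- move=> x y; split=> [/(factor_eq0 dm)/finite_point_eq//|->].
  exact: factorxx.
- by move=> x y; exact: csym.
- move=> x y z; have := ext_metric_triangle dm (sval x) (sval y) (sval z).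
  by rewrite !finite_distE -EFinD lee_fin.
- by move=> x y z u; exact: (factor_ptolemy Xptolemy Md).
- exact: line0.
- by move=> l s t [].
- move=> l a; apply: (@ptolemy_line_reparam l _ (fun s => s - a)) => s.
  + by rewrite /= addrC addKr.
  + by rewrite /= addrCA subrr addr0.
  + by move=> t; congr `|_|; ring.
- move=> l a; apply: (@ptolemy_line_reparam l _ (fun s => a - s)) => s.
  + by rewrite /= subKr.
  + by rewrite /= subKr.
  + by move=> t; rewrite distrC; congr `|_|; ring.
- exact: finite_reflection.
- exact: finite_inversion_lines.
Qed.

(** The balls of radius [1/2] around the finite points and the complement of
the closed unit ball around [o] cover the compact space. In a finite subcover,
two points at distance at least [1] from each other never share a ball. *)
Lemma finite_separated_bound (Xcompact : compact [set: mobius_space M])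
    (o : finite_point) :
  exists N, forall m (u : 'I_m -> finite_point), (forall i, D o (u i) <= 1) ->
    (forall i j, i != j -> 1 <= D (u i) (u j)) -> (m <= N)%N.
Proof.
have other (x : mobius_space M) : x <> w -> exists2 y, y <> w & x <> y.
  move=> xw; have [l [liso _]] := line0.
  have [xl|xl] := pselect (x = sval (l 0)); last first.
    by exists (sval (l 0)) => //; exact: (svalP (l 0)).
  exists (sval (l 1)); first exact: (svalP (l 1)).
  rewrite xl => /finite_point_eq ll; have := liso 0 1.
  rewrite ll /D (factorxx dm) sub0r normrN normr1 => /eqP.
  by rewrite eq_sym oner_eq0.
pose U (x : mobius_space M) : set (mobius_space M) :=
  if `[< x = w >] then ~` [set y | (d (sval o) y <= 1%:E)%E]
  else [set y | (d x y < (1 / 2)%:E)%E].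
have oU x : setT x -> open (U x).
  move=> _; rewrite /U; case: asboolP => [_|xw].
    have [y yw oy] := other _ (svalP o).
    exact: (open_coball Md dw (svalP o) yw oy ltr01).
  have [y yw xy] := other _ xw; apply: (open_ball Md dw xw yw xy).
  by rewrite divr_gt0.
have covU : [set: mobius_space M] `<=` cover setT U.
  move=> x _; exists x => //; rewrite /U; case: asboolP => [->|xw].
    exact: (coball_remote dw (svalP o)).
  by rewrite /= (ext_metric_eq0 dm x x).2// lte_fin divr_gt0.
have [F _ FU] := compact_finite_cover (w : mobius_space M) Xcompact oU covU.
exists (size (finmap.enum_fset F)) => m u uo usep.
have /choice[h hP] : forall i, exists x,
    x \in finmap.enum_fset F /\ U x (sval (u i)).
  by move=> i; have [x xF Ux] := FU (sval (u i)) I; exists x.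
have hw i : h i <> w.
  move=> hiw; have [_] := hP i; rewrite hiw /U asboolT//=.
  by rewrite finite_distE lee_fin.
have hinj : injective h.
  move=> i j hij; apply/eqP/negPn/negP => ij; have := usep i j ij.
  apply/negP; rewrite -ltNge.
  have [_] := hP i; have [_] := hP j; rewrite -hij /U asboolF//=.
  rewrite (remote_dist dm dw (hw i) (svalP (u i))).
  rewrite (remote_dist dm dw (hw i) (svalP (u j))) !lte_fin => hj hi.
  have := ext_metric_triangle dm (sval (u i)) (h i) (sval (u j)).
  rewrite finite_distE (remote_dist dm dw (svalP (u i)) (hw i)).
  rewrite (remote_dist dm dw (hw i) (svalP (u j))) -EFinD lee_fin.
  rewrite (csym (sval (u i)) (h i)) => /le_lt_trans; apply; lra.
have := @uniq_leq_size _ [seq h i | i <- enum 'I_m] (finmap.enum_fset F).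
rewrite map_inj_uniq// enum_uniq size_map size_enum_ord; apply=> //.
by move=> x /mapP[i _ ->]; have [] := hP i.
Qed.

End RemotePoint.

(** * The Moebius equivalence *)

Lemma ext_isometry_mobius (R : realType) (X Y : Type) (M : mobius_structure R X)
    (N : mobius_structure R Y) (d : X -> X -> \bar R) (e : Y -> Y -> \bar R)
    (f : X -> Y) : mobius_metrics M d -> mobius_metrics N e -> bijective f ->
  (forall x y, d x y = e (f x) (f y)) -> mobius_equivalent M N.
Proof.
move=> Md Ne fbij fiso; exists f; split=> //; split; first exact: bij_inj.
have inj := bij_inj fbij.
move=> d' e' Md' Ne' x y z u adm.
have adm' : admissible (f x) (f y) (f z) (f u).
  by case: adm => a1 a2 a3 a4; split=> -[/inj e1 /inj e2];
    [apply: a1|apply: a2|apply: a3|apply: a4].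
apply: (proj_eq_trans (mobius_metrics_equiv Md' Md adm)).
have -> : crt d x y z u = crt e (f x) (f y) (f z) (f u) by rewrite /crt !fiso.
exact: (mobius_metrics_equiv Ne Ne' adm').
Qed.

Lemma euclidean_mobius_metric (R : realType) n :
  mobius_metrics (euclidean_mobius R n) (@ext_euclidean_dist R n).
Proof.
split; first exact: ext_euclidean_is_ext_metric.
by move=> x y z u _; exists 1; rewrite oner_eq0 !mul1r.
Qed.

Local Close Scope ring_scope.
Unset Implicit Arguments.

Theorem theorem1 (R : realType) (X : Type) (M : mobius_structure R X)
  (Xcompact : compact [set: mobius_space M])
  (Xptolemy : is_ptolemy M)
  (XE : propertyE M)
  (XsI : property_sI M) :
  exists n : nat, (1 <= n)%N /\ mobius_equivalent M (euclidean_mobius R n).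
Proof.
have [sigma sc] := XE.
have [w wP] := ptolemy_circle_line sc.
have [d Md dw] := remote_metric_exists w Xptolemy.
have [l0 [l0w l0iso sE]] := wP d Md dw.
pose l t : finite_point w := exist (fun x => x <> w) (l0 t) (l0w t).
have Ll : ptolemy_line M d l by split=> //; rewrite -sE.
have line0 : exists m : R -> finite_point w, ptolemy_line M d m by exists l.
have mirror := finite_mirror_space Xptolemy XsI Md dw line0.
have [n [f [n1 [g fK gK] fD]]] :=
  mirror_space_euclidean mirror
    (finite_separated_bound Md dw line0 Xcompact (l 0%R)).
exists n; split=> //.
pose F (x : X) : option 'rV[R]_n :=
  if pselect (x = w) is right xw then Some (f (exist (fun x => x <> w) x xw))
  else None.
pose G (v : option 'rV[R]_n) : X := if v is Some v then sval (g v) else w.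
have Fw : F w = None by rewrite /F; case: pselect.
have FE (x : finite_point w) : F (sval x) = Some (f x).
  rewrite /F; case: pselect => [xw|xw]; first by case: (svalP x).
  by congr (Some (f _)); exact: finite_point_eq.
apply: (ext_isometry_mobius Md (euclidean_mobius_metric R n) (f := F)).
  exists G => [x|[v|]] /=; last exact: Fw.
    have [->|xw] := pselect (x = w); first by rewrite Fw.
    by rewrite (FE (exist (fun x => x <> w) x xw)) /= fK.
  by rewrite FE gK.
have dm := mobius_metrics_ext Md.
move=> x y; have [->|xw] := pselect (x = w); have [->|yw] := pselect (y = w).
- by rewrite Fw /=; exact/(ext_metric_eq0 dm).
- rewrite Fw (ext_metric_sym dm) dw// (FE (exist (fun x => x <> w) y yw)).
  by [].
- by rewrite Fw dw// (FE (exist (fun x => x <> w) x xw)).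
- rewrite (FE (exist (fun x => x <> w) x xw)).
  rewrite (FE (exist (fun x => x <> w) y yw)).
  by rewrite /= -fD -(finite_distE Md dw).
Qed.
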